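(* Let $$ c = 1-\int_0^{1/2} h(\alpha,\tfrac12)\,\mathrm{d}\alpha. $$ Then $0.651\le c\le 0.666$.
   Context: For $0\le\alpha\le\beta\le1$, $h(\alpha,\beta):=\lim_{x\to\infty}\frac1x\operatorname{card}\{n\in[1,x]\cap\mathbb{N} : \exists d\mid n,\ d\in[x^\alpha,x^\beta]\}$ (this limit is known to exist). The constant $c$ is the leading constant in the known estimate $\sum_{n\le x}\log d^*(n)=c\,x\log x+O(x)$, where $d^*(n)=\min\{d\mid n : d\ge\sqrt n\}$. *)

(* Defs.v *)
From Stdlib Require Import Reals List Arith ClassicalEpsilon.
From Coquelicot Require Import Coquelicot.
Import ListNotations.
Open Scope R_scope.

Definition has_divisor_between (y z : R) (n : nat) : Prop :=
  exists d : nat, Nat.divide d n /\ y <= INR d <= z.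

(* For x >= 0, [Int_part x] is the floor of x, so the list ranges over the
   integers n with 1 <= n <= x, each occurring once. [Rpower x a] is x^a for
   x > 0, which is all that matters as x tends to infinity. *)
Definition card_divisor_between (alpha beta x : R) : nat :=
  length
    (filter
       (fun n =>
          if excluded_middle_informative
               (has_divisor_between (Rpower x alpha) (Rpower x beta) n)
          then true else false)
       (seq 1 (Z.to_nat (Int_part x)))).

(* [Lim] is total: its value is the limit whenever the limit exists, as it is
   known to do here for 0 <= alpha <= beta <= 1. The quotient lies in [0, 1]
   for x > 0, so projecting from [Rbar] to [R] loses nothing. *)
Definition h (alpha beta : R) : R :=
  real (Lim (fun x => INR (card_divisor_between alpha beta x) / x) p_infty).

(* Main.v *)
From HB Require Import structures.
From mathcomp Require Import all_boot.
From mathcomp Require Import zify_ssreflect.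
Require Import Defs.
From Stdlib Require Import Reals Lra Lia ClassicalEpsilon.
From Coquelicot Require Import Coquelicot.
Delimit Scope nat_scope with N.
Open Scope R_scope.

(** Write [h(a)] for [h a (1 / 2)]; bounds on the proportion of integers
    [n <= x] with a divisor in [[x^a, x^(1/2)]] that hold for all large [x]
    are inherited by [h(a)].  The claim amounts to
    [0.334 <= RInt h 0 (1 / 2) <= 0.349].

    Upper bound.  If a prime [p > x^(1 - a)] divides [n <= x], then [n] has no
    divisor in [[x^a, x^(1/2)]]: a divisor is either a multiple of [p], too
    large, or divides [n / p < x^a].  By Mertens' theorem such [n] have density
    [- ln (1 - a)], so [h(a) <= 1 + ln (1 - a)] ([h_upper]), and the integral of
    the right-hand side over [[0, 1/2]] is [ln 2 / 2 = 0.3465...].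

    Lower bound.  Let [n] be close to [x] on a logarithmic scale, without
    divisor in [[x^a, x^(1/2)]].  Since [d] divides [n] exactly when [n / d]
    does, [n] has no divisor in [[x^a, x^(1 - a)]] either, up to [x^eps].  So
    either a prime larger than [x^(1 - a)] divides [n], which has density
    [- ln (1 - a)], or all the primes dividing [n] are below [x^a] and yet no
    product of them lands in that window.  Call the latter [n] bad
    ([bad]), of upper density [F(a)]; then [h(a) >= 1 + ln (1 - a) - F(a)]
    ([h_lower]), and it remains to see that [F] has integral at most [0.0124].

    To bound [F], pick a prime factor of [n] at random with probability
    proportional to its logarithm: [ln n] is the sum of [ln p] over the prime
    factors, up to an error that is bounded on average
    ([sum_ln_le_prime_factors]).  As the sum of [ln p / p] over [p <= y] is
    [ln y + O(1)], the exponent [u] in [p = x^u] is asymptotically uniform on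
    [[0, 1]].  Picking again in [n / p], and so on, the exponents of the
    successive picks follow the stick-breaking process, and [F(a)] is at most
    the probability that, after four picks, all exponents are below [a] and no
    sum of some of them lies in [[a, 1 - a]].  The exponents are rounded to
    cells of a grid of mesh [1 / 96] ([bad_density_step]), which turns this
    probability into an explicit finite sum ([pick_bound]).  Summing over the
    values of [a] on the grid replaces the indicator that the picks miss the
    window of [a] by the number of [a] for which they do, the [gap] between
    [1 / 2] and the range of [a] already excluded.  The resulting single sum
    ([gap_bound]) is evaluated in fixed-point arithmetic ([grid_value_le]).

    As [h] is monotone, it is integrable ([ex_RInt_antitone]), and
    the pointwise bounds can be integrated. *)

(** * Finite sums of real numbers *)

HB.instance Definition _ :=
  Monoid.isComLaw.Build R 0 Rplus
    (fun x y z => esym (Rplus_assoc x y z)) Rplus_comm Rplus_0_l.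
HB.instance Definition _ := Monoid.isMulLaw.Build R 0 Rmult Rmult_0_l Rmult_0_r.
HB.instance Definition _ :=
  Monoid.isAddLaw.Build R Rmult Rplus
    Rmult_plus_distr_r Rmult_plus_distr_l.

Notation "\rsum_ ( m <= i < n | P ) F" :=
  (\big[Rplus/0]_(m%N <= i < n%N | P%B) F%R)
  (at level 34, F at level 39, i, m, n at level 50) : R_scope.
Notation "\rsum_ ( m <= i < n ) F" :=
  (\big[Rplus/0]_(m%N <= i < n%N) F%R)
  (at level 34, F at level 39, i, m, n at level 50) : R_scope.

(** Classical truth value, so that arbitrary propositions can filter sums. *)
Definition holds (P : Prop) : bool :=
  if excluded_middle_informative P then true else false.

Lemma holdsP (P : Prop) : reflect P (holds P).
Proof. by rewrite /holds; case: excluded_middle_informative => H; constructor. Qed.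

Lemma INR_addn (m n : nat) : INR (m + n)%N = INR m + INR n.
Proof. exact: plus_INR. Qed.

Lemma INR_muln (m n : nat) : INR (m * n)%N = INR m * INR n.
Proof. exact: mult_INR. Qed.

Lemma INR_leq (m n : nat) : (m <= n)%N -> INR m <= INR n.
Proof. by move=> h; apply: le_INR; lia. Qed.

Lemma INR_ltn (m n : nat) : (m < n)%N -> INR m < INR n.
Proof. by move=> h; apply: lt_INR; lia. Qed.

Lemma INR_expn (m n : nat) : INR (expn m n) = INR m ^ n.
Proof. by elim: n => [|n IH] //=; rewrite expnS INR_muln IH. Qed.

Lemma INR_gt0 (n : nat) : (0 < n)%N -> 0 < INR n.
Proof. by move=> /INR_ltn. Qed.

Lemma INR_ge1 (n : nat) : (0 < n)%N -> 1 <= INR n.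
Proof. by move=> /INR_leq. Qed.

Section FiniteSums.
Variables (r : seq nat) (P : pred nat).

Lemma rsum_le (F G : nat -> R) :
  (forall i, i \in r -> P i -> F i <= G i) ->
  \big[Rplus/0]_(i <- r | P i) F i <= \big[Rplus/0]_(i <- r | P i) G i.
Proof.
elim: r => [|a s IH] h; first by rewrite !big_nil; lra.
rewrite !big_cons; have hs := IH (fun i hi => h i (mem_behead (s := a :: s) hi)).
case: ifP => // Pa; have := h a (mem_head a s) Pa; lra.
Qed.

Lemma rsum_ge0 (F : nat -> R) :
  (forall i, i \in r -> P i -> 0 <= F i) ->
  0 <= \big[Rplus/0]_(i <- r | P i) F i.
Proof.
move=> h; apply: (Rle_trans _ (\big[Rplus/0]_(i <- r | P i) 0)).
  by rewrite big1_eq; lra.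
exact: rsum_le.
Qed.

Lemma rsum_sub (Q : pred nat) (F : nat -> R) :
  (forall i, i \in r -> P i -> Q i) ->
  (forall i, i \in r -> Q i -> 0 <= F i) ->
  \big[Rplus/0]_(i <- r | P i) F i <= \big[Rplus/0]_(i <- r | Q i) F i.
Proof.
move=> hPQ hF; rewrite [X in X <= _]big_mkcond [X in _ <= X]big_mkcond /=.
elim: r hPQ hF => [|a s IH] hPQ hF; first by rewrite !big_nil; lra.
rewrite !big_cons.
have := IH (fun i hi => hPQ i (mem_behead (s := a :: s) hi))
           (fun i hi => hF i (mem_behead (s := a :: s) hi)).
case: ifP => Pa; case: ifP => Qa; have := hF a (mem_head a s); rewrite ?Qa.
- lra.
- by have := hPQ a (mem_head a s) Pa; rewrite Qa.
- by move=> /(_ erefl); lra.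
- lra.
Qed.

Lemma rsum_const (c : R) :
  \big[Rplus/0]_(i <- r | P i) c = INR (count P r) * c.
Proof.
elim: r => [|a s IH]; first by rewrite big_nil /=; lra.
rewrite big_cons IH /=; case: ifP => Pa; rewrite INR_addn /=; lra.
Qed.

Lemma rsumB (F G : nat -> R) :
  \big[Rplus/0]_(i <- r | P i) (F i - G i) =
  \big[Rplus/0]_(i <- r | P i) F i - \big[Rplus/0]_(i <- r | P i) G i.
Proof.
elim: r => [|a s IH]; first by rewrite !big_nil; lra.
rewrite !big_cons IH; case: ifP => _; lra.
Qed.

End FiniteSums.

Lemma rsum_nat_le (m n : nat) (P : pred nat) (F G : nat -> R) :
  (forall i, (m <= i < n)%N -> P i -> F i <= G i) ->
  \rsum_(m <= i < n | P i) F i <= \rsum_(m <= i < n | P i) G i.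
Proof. by move=> h; apply: rsum_le => i; rewrite mem_index_iota; apply: h. Qed.

Lemma rsum_nat_ge0 (m n : nat) (P : pred nat) (F : nat -> R) :
  (forall i, (m <= i < n)%N -> P i -> 0 <= F i) ->
  0 <= \rsum_(m <= i < n | P i) F i.
Proof. by move=> h; apply: rsum_ge0 => i; rewrite mem_index_iota; apply: h. Qed.

Lemma rsum_nat_sub (m n : nat) (P Q : pred nat) (F : nat -> R) :
  (forall i, (m <= i < n)%N -> P i -> Q i) ->
  (forall i, (m <= i < n)%N -> Q i -> 0 <= F i) ->
  \rsum_(m <= i < n | P i) F i <= \rsum_(m <= i < n | Q i) F i.
Proof.
by move=> h h'; apply: rsum_sub => i; rewrite mem_index_iota; [apply: h | apply: h'].
Qed.

Lemma rsum_nat_const (n : nat) (c : R) : \rsum_(1 <= i < n.+1) c = INR n * c.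
Proof. by rewrite rsum_const count_predT size_iota subn1. Qed.

Lemma rsum_nat_widen (m n n' : nat) (P : pred nat) (F : nat -> R) :
  (n <= n')%N -> (forall i, (m <= i < n')%N -> P i -> 0 <= F i) ->
  \rsum_(m <= i < n | P i) F i <= \rsum_(m <= i < n' | P i) F i.
Proof.
move=> hn h; rewrite (big_nat_widen _ _ _ _ _ hn).
by apply: rsum_nat_sub => i hi; [case/andP | apply: h].
Qed.

Lemma rsum_multiples (p Y : nat) (F : nat -> R) : (0 < p)%N ->
  \rsum_(1 <= m < Y.+1 | p %| m) F m = \rsum_(1 <= k < (Y %/ p).+1) F (p * k)%N.
Proof.
move=> p_gt0; elim: Y => [|Y IH]; first by rewrite div0n !big_geq.
rewrite big_mkcond big_nat_recr //= -big_mkcond IH /= divnS //.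
case: ifP => /= h; last by rewrite add0n Rplus_0_r.
rewrite add1n [in RHS]big_nat_recr //=; congr (_ + F _).
by have := divnS Y p_gt0; rewrite h add1n => <-; rewrite mulnC divnK.
Qed.

Lemma INR_divn_le (Y p : nat) : (0 < p)%N -> INR (Y %/ p) <= INR Y / INR p.
Proof.
move=> p_gt0; have hp := INR_gt0 _ p_gt0.
apply: (Rmult_le_reg_r (INR p)) => //.
have -> : INR Y / INR p * INR p = INR Y by field; lra.
by rewrite -INR_muln; apply: INR_leq; apply: leq_divM.
Qed.

Lemma INR_divn_gt (Y p : nat) : (0 < p)%N -> INR Y / INR p - 1 < INR (Y %/ p).
Proof.
move=> p_gt0; have hp := INR_gt0 _ p_gt0.
apply: (Rmult_lt_reg_r (INR p)) => //.
have -> : (INR Y / INR p - 1) * INR p = INR Y - INR p by field; lra.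
have := INR_ltn _ _ (ltn_ceil Y p_gt0); rewrite mulSn INR_addn -INR_muln; lra.
Qed.

Lemma count_le_real (X : nat) (y : R) (Q : pred nat) : 0 <= y ->
  (forall n, (0 < n)%N -> Q n -> INR n <= y) -> \rsum_(1 <= n < X.+1 | Q n) 1 <= y.
Proof.
move=> hy hQ; have [M [hM1 hM2]] := nfloor_ex y hy.
apply: (Rle_trans _ (INR M * 1)); last lra.
rewrite -rsum_nat_const [X in X <= _]big_mkcond /=.
have hQM n : (0 < n)%N -> Q n -> (n <= M)%N.
  move=> hn /(hQ n hn) h; rewrite leqNgt; apply/negP => /INR_leq.
  by rewrite S_INR; lra.
have [hXM|hMX] := leqP X M.
  apply: (Rle_trans _ (\rsum_(1 <= n < X.+1) 1)).
    by apply: rsum_nat_le => n _ _; case: ifP => _; lra.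
  by apply: rsum_nat_widen => [|*]; [lia | lra].
have hMX' : (M.+1 <= X.+1)%N by lia.
rewrite (big_nat_widen _ _ _ _ _ hMX') -big_mkcond /=.
by apply: rsum_nat_sub => [n /andP[hn _] /(hQM n hn)|*] //; lra.
Qed.

(** * Mertens' first theorem *)

Lemma ln_ge0 (n : nat) : 0 <= ln (INR n).
Proof.
case: n => [|n]; last first.
  by rewrite -ln_1; apply: ln_le; [lra | exact: (INR_ge1 n.+1 isT)].
rewrite /ln; case: Rlt_dec => [h|_]; [by case: (Rlt_irrefl 0) | exact: Rle_refl].
Qed.

Lemma ln_le_sub1 (x : R) : 0 < x -> ln x <= x - 1.
Proof. by move=> hx; have := exp_ineq1_le (ln x); rewrite exp_ln //; lra. Qed.

Lemma ln_ge_1_inv (x : R) : 0 < x -> 1 - 1 / x <= ln x.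
Proof.
move=> hx; have hx' : 0 < / x by apply: Rinv_0_lt_compat.
by have := ln_le_sub1 _ hx'; rewrite ln_Rinv //; lra.
Qed.

(** The fundamental theorem of arithmetic in logarithmic form; any bound [Y]
    beyond [m] can be used, which lets sums over [m] be exchanged with sums over
    [p]. *)
Lemma ln_factorization (m Y : nat) : (0 < m <= Y)%N ->
  ln (INR m) = \rsum_(1 <= p < Y.+1 | prime p) (INR (logn p m) * ln (INR p)).
Proof.
case/andP=> m_gt0 mY.
have hm := widen_partn predT mY; rewrite partnT // in hm.
have -> : ln (INR m) = \rsum_(0 <= p < Y.+1) (INR (logn p m) * ln (INR p)).
  rewrite [in LHS]hm.
  elim: (Y.+1) => [|n IH]; first by rewrite !big_geq //= ln_1.
  rewrite 2?big_nat_recr //= INR_muln INR_expn -IH.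
  have hprod : 0 < INR (\prod_(0 <= i < n | i \in predT) expn i (logn i m)).
    apply: INR_gt0; apply: prodn_gt0 => i; rewrite expn_gt0.
    by case: i => [|i] //; rewrite logn0 ?lognE.
  case: n {IH} hprod => [|n] hprod.
    by rewrite big_geq // lognE /= Rmult_1_r Rmult_0_l Rplus_0_r.
  rewrite ln_mult //; last by apply: pow_lt; apply: (INR_gt0 n.+1).
  by rewrite ln_pow //; apply: (INR_gt0 n.+1).
rewrite big_nat_recl // {1}lognE /= Rmult_0_l Rplus_0_l.
rewrite [in RHS]big_mkcond /= [in RHS]big_add1 /=.
apply: eq_bigr => p _; case: ifP => // hp; rewrite lognE hp /=; ring.
Qed.

Definition sum_ln (X : nat) : R := \rsum_(1 <= m < X.+1) ln (INR m).
Definition theta (X : nat) : R := \rsum_(1 <= p < X.+1 | prime p) ln (INR p).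
Definition mertens (X : nat) : R :=
  \rsum_(1 <= p < X.+1 | prime p) (ln (INR p) / INR p).
(** The [p]-adic valuation of [Y!]. *)
Definition sum_logn (p Y : nat) : R := \rsum_(1 <= m < Y.+1) INR (logn p m).

Lemma sum_ln_le (X : nat) : sum_ln X <= INR X * ln (INR X).
Proof.
rewrite /sum_ln -rsum_nat_const; apply: rsum_nat_le => i hi _.
by apply: ln_le; [apply: INR_gt0 | apply: INR_leq]; lia.
Qed.

Lemma sum_ln_ge (X : nat) : INR X * ln (INR X) - INR X <= sum_ln X.
Proof.
rewrite /sum_ln; elim: X => [|X IH]; first by rewrite big_geq //=; lra.
rewrite big_nat_recr //=.
have [->|X_gt0] := posnP X; first by rewrite big_geq //= ln_1; lra.
have hX := INR_gt0 _ X_gt0; have hX1 : INR X.+1 = INR X + 1 by rewrite S_INR.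
rewrite -/(INR X.+1) hX1.
have : INR X * (ln (INR X + 1) - ln (INR X)) <= 1.
  rewrite -ln_div; [|lra|lra].
  have -> : (INR X + 1) / INR X = 1 + / INR X by field; lra.
  have h : 0 < / INR X by apply: Rinv_0_lt_compat.
  have := ln_le_sub1 (1 + / INR X) ltac:(lra) => h2.
  apply: (Rle_trans _ (INR X * / INR X)); last by rewrite Rinv_r; lra.
  by apply: Rmult_le_compat_l; lra.
by move: IH; set S := bigop _ _ _ => IH; nra.
Qed.

Section PrimeMultiplicity.
Variables (p : nat) (p_prime : prime p).

Let p_gt0 : (0 < p)%N := prime_gt0 p_prime.

(** Only multiples of [p] count, and [p * k] has one more factor [p] than [k]:
    this recursion replaces Legendre's formula in what follows. *)
Lemma sum_logn_rec (Y : nat) :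
  sum_logn p Y = INR (Y %/ p) + sum_logn p (Y %/ p).
Proof.
rewrite /sum_logn (bigID (fun m => p %| m)) /= [X in _ + X]big1; last first.
  by move=> m hm; rewrite lognE (negbTE hm) !andbF.
rewrite Rplus_0_r rsum_multiples //.
rewrite -[INR (Y %/ p)]Rmult_1_r -rsum_nat_const -big_split /=.
apply: eq_big_nat => k /andP[k_gt0 _].
by rewrite lognM // logn_prime // eqxx INR_addn.
Qed.

Lemma sum_logn_ge0 (Y : nat) : 0 <= sum_logn p Y.
Proof. by apply: rsum_nat_ge0 => i _ _; apply: pos_INR. Qed.

Lemma sum_logn_ge (Y : nat) : INR (Y %/ p) <= sum_logn p Y.
Proof. by have := sum_logn_ge0 (Y %/ p); rewrite (sum_logn_rec Y); lra. Qed.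

Lemma sum_logn_le (Y : nat) : sum_logn p Y <= INR Y / (INR p - 1).
Proof.
have hp : 2 <= INR p by have := INR_leq _ _ (prime_gt1 p_prime).
have [n] := ubnP Y; elim: n Y => // n IH Y hY.
have [->|Y_gt0] := posnP Y.
  by rewrite /sum_logn big_geq //= /Rdiv Rmult_0_l; lra.
rewrite (sum_logn_rec Y).
have hlt : (Y %/ p < n)%N.
  by have := ltn_Pdiv (prime_gt1 p_prime) Y_gt0; lia.
have := IH _ hlt; have := INR_divn_le Y p p_gt0 => h1 h2.
have hi : 0 < / (INR p - 1) by apply: Rinv_0_lt_compat; lra.
apply: (Rle_trans _ (INR (Y %/ p) * (1 + / (INR p - 1)))).
  by move: h2; rewrite /Rdiv; lra.
have -> : INR Y / (INR p - 1) = INR Y / INR p * (1 + / (INR p - 1)).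
  by field; lra.
by apply: Rmult_le_compat_r; lra.
Qed.

Lemma sum_logn_mono (Y Z : nat) : (Y <= Z)%N -> sum_logn p Y <= sum_logn p Z.
Proof.
by move=> h; apply: rsum_nat_widen => [|i _ _]; [lia | exact: pos_INR].
Qed.

Lemma sum_logn_double (n : nat) : 2 * sum_logn p n <= sum_logn p (2 * n).
Proof.
have [k] := ubnP n; elim: k n => // k IH n hn.
have [->|n_gt0] := posnP n.
  by rewrite muln0 /sum_logn big_geq //=; lra.
have hlt : (n %/ p < k)%N.
  by have := ltn_Pdiv (prime_gt1 p_prime) n_gt0; lia.
have hdiv : (2 * (n %/ p) <= (2 * n) %/ p)%N.
  by rewrite leq_divRL // -mulnA leq_mul2l leq_divM orbT.
rewrite (sum_logn_rec n) (sum_logn_rec (2 * n)); have := IH _ hlt; have := sum_logn_mono _ _ hdiv.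
by have := INR_leq _ _ hdiv; rewrite INR_muln /=; lra.
Qed.

End PrimeMultiplicity.

Lemma sum_ln_primes (Y : nat) :
  sum_ln Y = \rsum_(1 <= p < Y.+1 | prime p) (ln (INR p) * sum_logn p Y).
Proof.
rewrite /sum_ln (eq_big_nat _ _ (F2 := fun m =>
  \rsum_(1 <= p < Y.+1 | prime p) (INR (logn p m) * ln (INR p)))); last first.
  by move=> m hm; apply: ln_factorization; lia.
rewrite exchange_big /=; apply: eq_bigr => p _.
rewrite /sum_logn big_distrr /=; apply: eq_bigr => m _; ring.
Qed.

(** Chebyshev's argument on the central binomial coefficient: the left side is
    at most [ln ((2n)! / n!^2)], because a prime between [n] and [2 * n] divides
    [(2n)!] and not [n!]. *)
Lemma theta_double (n : nat) : theta (2 * n) - theta n <= 4 * INR n.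
Proof.
have [->|n_gt0] := posnP n; first by rewrite muln0 /=; lra.
apply: (Rle_trans _ (sum_ln (2 * n) - 2 * sum_ln n)); last first.
  have := sum_ln_le (2 * n); have := sum_ln_ge n; rewrite INR_muln.
  have hn := INR_gt0 _ n_gt0; rewrite ln_mult /=; [|lra|lra].
  have := ln_le_sub1 2 ltac:(lra) => h.
  have -> : 1 + 1 = 2 by ring.
  by move=> h1 h2; nra.
have hle : (n.+1 <= (2 * n).+1)%N by lia.
rewrite !sum_ln_primes /theta !(big_nat_widen _ _ _ _ _ hle).
rewrite !(big_mkcondr _ _ prime) /= big_distrr /= -!rsumB.
apply: rsum_nat_le => p hp p_prime.
have hl := ln_ge0 p; have hd := sum_logn_double p p_prime n.
case: ifP => hpn.
  have : sum_logn p n = sum_logn p n by [].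
  nra.
have h1 : (1 <= (2 * n) %/ p)%N by rewrite divn_gt0; lia.
have := INR_leq _ _ h1; have := sum_logn_ge p p_prime (2 * n) => /= h2 h3.
nra.
Qed.

Lemma theta_le (X : nat) : theta X <= 6 * INR X.
Proof.
have [k] := ubnP X; elim: k X => // k IH X hX.
have [->|X_gt0] := posnP X; first by rewrite /theta big_geq //=; lra.
set n := X./2.
have hn : (n < k)%N by rewrite /n; lia.
have h1 := IH _ hn; have h2 := theta_double n.
have hX2 : INR X = INR (odd X) + 2 * INR n.
  by rewrite -[in LHS](odd_double_half X) INR_addn -mul2n INR_muln.
have : theta X <= theta (2 * n) + 2 * INR n.
  rewrite -[in X in X <= _](odd_double_half X) -/n -mul2n.
  case: (odd X) => /=; last by rewrite add0n; have := pos_INR n; lra.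
  rewrite add1n /theta big_mkcond big_nat_recr //= -big_mkcond -/(INR (2 * n).+1).
  case: ifP => _; last by have := pos_INR n; set S := bigop _ _ _; lra.
  have := ln_le_sub1 (INR (2 * n).+1) (INR_gt0 (2 * n).+1 isT).
  by rewrite S_INR INR_muln; change (INR 2) with (1 + 1); set S := bigop _ _ _; lra.
have := pos_INR (odd X); lra.
Qed.

Lemma prime_ge2 (p : nat) : prime p -> 2 <= INR p.
Proof. by move=> h; have := INR_leq _ _ (prime_gt1 h). Qed.

(** The terms telescope against [(ln n + 2) / n].  This series bounds the total
    contribution of prime powers with exponent at least two. *)
Lemma sum_ln_over_square_le (X : nat) :
  \rsum_(1 <= p < X.+1 | prime p) (ln (INR p) / (INR p * (INR p - 1))) <= 2.
Proof.
apply: (Rle_trans _ (2 - (ln (INR X) + 2) / INR X)); last first.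
  have [->|X_gt0] := posnP X.
    by rewrite /= /Rdiv Rinv_0 Rmult_0_r; lra.
  have := ln_ge0 X; have hx := INR_gt0 _ X_gt0 => hl.
  have : 0 <= (ln (INR X) + 2) / INR X by apply: Rdiv_le_0_compat; lra.
  lra.
elim: X => [|X IH].
  by rewrite big_geq //= /Rdiv Rinv_0 Rmult_0_r; lra.
have [X0|X_gt0] := posnP X.
  by rewrite X0 big_mkcond big_nat1 /= ln_1; lra.
rewrite big_mkcond big_nat_recr //= -big_mkcond -!/(INR X.+1).
apply: (Rle_trans _ (2 - (ln (INR X) + 2) / INR X
   + ln (INR X.+1) / (INR X.+1 * (INR X.+1 - 1)))).
  apply: Rplus_le_compat => //; case: ifP => _; first exact: Rle_refl.
  apply: Rdiv_le_0_compat; first exact: ln_ge0.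
  have := INR_ge1 _ X_gt0; rewrite S_INR => h; nra.
rewrite S_INR; set x := INR X; have hx : 1 <= x by apply: INR_ge1.
have hl : ln (x + 1) <= ln x + 1 / x.
  have := ln_le_sub1 ((x + 1) / x).
  rewrite ln_div; [|lra|lra].
  have -> : (x + 1) / x = 1 + 1 / x by field; lra.
  have : 0 < 1 / x by apply: Rdiv_lt_0_compat; lra.
  by move=> ha hb; have := hb ltac:(lra); lra.
apply/Rminus_le_0.
have -> : 2 - (ln (x + 1) + 2) / (x + 1)
  - (2 - (ln x + 2) / x + ln (x + 1) / ((x + 1) * (x + 1 - 1)))
  = ((x + 1) * (ln x + 2) - x * (ln (x + 1) + 2) - ln (x + 1)) / (x * (x + 1)).
  by field; lra.
apply: Rdiv_le_0_compat; last nra.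
have : (x + 1) * (ln (x + 1) - ln x) <= (x + 1) * (1 / x).
  by apply: Rmult_le_compat_l; lra.
have -> : (x + 1) * (1 / x) = 1 + 1 / x by field; lra.
have : 1 / x <= 1.
  by apply: (Rmult_le_reg_r x); [lra|]; rewrite /Rdiv Rmult_assoc Rinv_l; lra.
lra.
Qed.

(** Both halves of Mertens' theorem compare two evaluations of [ln X!], by
    Stirling and by prime factors.  Here the integer parts [X / p] cost
    [theta X], which Chebyshev's bound controls. *)
Lemma mertens_le (X : nat) : (0 < X)%N -> mertens X <= ln (INR X) + 6.
Proof.
move=> X_gt0; have hX := INR_gt0 _ X_gt0.
apply: (Rmult_le_reg_l (INR X)) => //.
have h : INR X * mertens X - theta X <= sum_ln X.
  rewrite sum_ln_primes /mertens /theta big_distrr /= -rsumB.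
  apply: rsum_nat_le => p hp p_prime.
  have hp2 := prime_ge2 _ p_prime; have hl := ln_ge0 p.
  have h1 := INR_divn_gt X p (prime_gt0 p_prime).
  have h2 := sum_logn_ge p p_prime X.
  have -> : INR X * (ln (INR p) / INR p) - ln (INR p)
     = ln (INR p) * (INR X / INR p - 1) by field; lra.
  by apply: Rmult_le_compat_l; lra.
have := sum_ln_le X; have := theta_le X; lra.
Qed.

(** Here the higher powers of the primes are what has to be controlled. *)
Lemma mertens_ge (X : nat) : (0 < X)%N -> ln (INR X) - 3 <= mertens X.
Proof.
move=> X_gt0; have hX := INR_gt0 _ X_gt0.
apply: (Rmult_le_reg_l (INR X)) => //.
have h : sum_ln X <= INR X * (mertens X + 
  \rsum_(1 <= p < X.+1 | prime p) (ln (INR p) / (INR p * (INR p - 1)))).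
  rewrite sum_ln_primes /mertens -big_split /= big_distrr /=.
  apply: rsum_nat_le => p hp p_prime.
  have hp2 := prime_ge2 _ p_prime; have hl := ln_ge0 p.
  have h2 := sum_logn_le p p_prime X.
  have -> : INR X * (ln (INR p) / INR p + ln (INR p) / (INR p * (INR p - 1)))
     = ln (INR p) * (INR X / (INR p - 1)) by field; lra.
  by apply: Rmult_le_compat_l; lra.
have := sum_ln_ge X; have := sum_ln_over_square_le X; nra.
Qed.

(** The random choice of a prime factor.  If every [ln m] is spread over the
    prime factors of [m], a prime [p] receives [ln p] from each [m = p * k] in
    [B]; repeated factors account for the error [2 * Y].  Thus, to count [B], it
    suffices to count the cofactors [k] for each [p]. *)
Lemma sum_ln_le_prime_factors (B : pred nat) (Y : nat) :
  \rsum_(1 <= m < Y.+1 | B m) ln (INR m) <=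
  \rsum_(1 <= p < Y.+1 | prime p)
     (ln (INR p) * \rsum_(1 <= k < (Y %/ p).+1 | B (p * k)%N) 1) + 2 * INR Y.
Proof.
rewrite big_mkcond /= (eq_big_nat _ _ (F2 := fun m =>
  \rsum_(1 <= p < Y.+1 | prime p)
    (if B m then INR (logn p m) * ln (INR p) else 0))); last first.
  move=> m hm; case: ifP => _; last by rewrite big1_eq.
  by apply: ln_factorization; lia.
rewrite exchange_big /=.
apply: (Rle_trans _ (\rsum_(1 <= p < Y.+1 | prime p)
   (ln (INR p) * \rsum_(1 <= k < (Y %/ p).+1 | B (p * k)%N) 1
    + INR Y * (ln (INR p) / (INR p * (INR p - 1)))))); last first.
  rewrite big_split /= -big_distrr /=; apply: Rplus_le_compat_l.
  by have := sum_ln_over_square_le Y; have := pos_INR Y; nra.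
apply: rsum_nat_le => p _ p_prime.
have p_gt0 := prime_gt0 p_prime; have hp2 := prime_ge2 _ p_prime.
have hl := ln_ge0 p.
rewrite (bigID (fun m => p %| m)) /= [X in _ + X]big1; last first.
  by move=> m hm; rewrite lognE (negbTE hm) !andbF /= Rmult_0_l; case: ifP.
rewrite Rplus_0_r rsum_multiples // [X in _ * X + _]big_mkcond /=.
apply: (Rle_trans _ (ln (INR p) * (\rsum_(1 <= k < (Y %/ p).+1)
   (if B (p * k)%N then 1 else 0) + sum_logn p (Y %/ p)))).
  rewrite /sum_logn -big_split big_distrr /=; apply: rsum_nat_le => k hk _.
  have := pos_INR (logn p k) => h.
  case: ifP => _; last by apply: Rmult_le_pos; lra.
  have -> : logn p (p * k) = (1 + logn p k)%N.
    by rewrite lognM //; [rewrite logn_prime // eqxx | lia].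
  by rewrite INR_addn /=; lra.
rewrite Rmult_plus_distr_l; apply: Rplus_le_compat_l.
have h1 := sum_logn_le p p_prime (Y %/ p).
have h2 := INR_divn_le Y p p_gt0.
have -> : INR Y * (ln (INR p) / (INR p * (INR p - 1)))
  = ln (INR p) * (INR Y / INR p / (INR p - 1)) by field; lra.
apply: Rmult_le_compat_l => //; apply: (Rle_trans _ _ _ h1).
by apply: Rmult_le_compat_r => //; apply: Rlt_le; apply: Rinv_0_lt_compat; lra.
Qed.

(** * Primes on a logarithmic scale *)

Definition prime_in (u v : R) (p : nat) : bool :=
  prime p && holds (u < INR p <= v).

Lemma eventually_ln_ge (M : R) : eventually (fun X => M <= ln (INR X)).
Proof.
have [n hn] := nfloor_ex (exp M) (Rlt_le _ _ (exp_pos M)).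
exists n.+1 => X hX.
rewrite -[M]ln_exp; apply: ln_le; first exact: exp_pos.
by have := INR_leq n.+1 X ltac:(lia); rewrite S_INR; lra.
Qed.

Lemma eventually_gt1 : eventually (fun X => 1 < INR X).
Proof. by exists 2%N => X hX; apply: (lt_INR 1); lia. Qed.

Lemma ln2_le1 : ln 2 <= 1.
Proof. by have := ln_le_sub1 2 ltac:(lra); lra. Qed.

Lemma ln_nfloor_ge (n : nat) (u : R) : 1 <= u -> INR n <= u < INR n + 1 ->
  (0 < n)%N /\ ln u - 1 <= ln (INR n).
Proof.
move=> hu hn.
have n_gt0 : (0 < n)%N by case: n hn => //=; lra.
split=> //; have h1 := INR_ge1 _ n_gt0.
have : ln u <= ln (2 * INR n) by apply: ln_le; lra.
rewrite ln_mult; [|lra|lra]; have := ln2_le1; lra.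
Qed.

(** The constant is [6 + 3] from Mertens' theorem at both ends, plus one for
    rounding the ends to integers. *)
Lemma mertens_interval (X : nat) (u v : R) : 1 <= u <= v -> v <= INR X ->
  ln v - ln u - 10 <=
    \rsum_(1 <= p < X.+1 | prime_in u v p) (ln (INR p) / INR p)
  <= ln v - ln u + 10.
Proof.
move=> huv hX.
have [U hU] := nfloor_ex u ltac:(lra); have [V hV] := nfloor_ex v ltac:(lra).
have [U_gt0 lnU] := ln_nfloor_ge U u ltac:(lra) hU.
have [V_gt0 lnV] := ln_nfloor_ge V v ltac:(lra) hV.
have lnU' : ln (INR U) <= ln u by apply: ln_le; [apply: INR_gt0 | lra].
have lnV' : ln (INR V) <= ln v by apply: ln_le; [apply: INR_gt0 | lra].
have hVX : (V <= X)%N.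
  by rewrite leqNgt; apply/negP => /INR_leq; rewrite S_INR; lra.
have hUV : (U <= V)%N.
  by rewrite leqNgt; apply/negP => /INR_leq; rewrite S_INR; lra.
have -> : \rsum_(1 <= p < X.+1 | prime_in u v p) (ln (INR p) / INR p)
   = mertens V - mertens U.
  have hV1 : (V.+1 <= X.+1)%N by []. 
  have hU1 : (U.+1 <= X.+1)%N by lia.
  rewrite /mertens (big_nat_widen _ _ _ _ _ hV1) (big_nat_widen _ _ _ _ _ hU1).
  rewrite [X in _ = X - _](bigID (fun p => (p < U.+1)%N)) /=.
  rewrite [X in _ = X + _ - _](eq_bigl (fun p => prime p && (p < U.+1)%N)); last first.
    by move=> p /=; case: (prime p) => //=; lia.
  rewrite [in RHS]Rplus_comm /Rminus Rplus_assoc Rplus_opp_r Rplus_0_r.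
  apply: eq_bigl => p; rewrite /prime_in; case: (prime p) => //=.
  apply/holdsP/andP => [[h1 h2]|[]].
    split.
      by rewrite ltnS leqNgt; apply/negP => /INR_leq; rewrite S_INR; lra.
    by rewrite ltnS leqNgt negbK; apply/negP => /negP;
       rewrite -leqNgt => /INR_leq; lra.
  move=> /INR_leq; rewrite !S_INR => h1; rewrite -ltnNge => /INR_leq.
  rewrite !S_INR; lra.
have := mertens_le V V_gt0; have := mertens_ge V V_gt0.
have := mertens_le U U_gt0; have := mertens_ge U U_gt0; lra.
Qed.

Definition recip (X : nat) (a b : R) : R :=
  \rsum_(1 <= p < X.+1 | prime_in (Rpower (INR X) a) (Rpower (INR X) b) p)
     (/ INR p).

Lemma ln_Rpower (x a : R) : ln (Rpower x a) = a * ln x.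
Proof. by rewrite /Rpower ln_exp. Qed.

Lemma Rpower_le_self (X : nat) (b : R) :
  1 < INR X -> b <= 1 -> Rpower (INR X) b <= INR X.
Proof.
move=> hX hb; apply: (Rle_trans _ (Rpower (INR X) 1)).
  by apply: Rle_Rpower; lra.
by rewrite Rpower_1; lra.
Qed.

Lemma Rpower_ge1 (x a : R) : 1 < x -> 0 <= a -> 1 <= Rpower x a.
Proof.
move=> hx ha; apply: (Rle_trans _ (Rpower x 0)); last by apply: Rle_Rpower; lra.
by rewrite Rpower_O; lra.
Qed.

Lemma ln_gt0_R (x : R) : 0 < ln x -> 1 < x.
Proof.
move=> h; case: (Rlt_or_le 1 x) => // hx; exfalso; case: (Rlt_or_le 0 x) => h0.
  by have := ln_le _ _ h0 hx; rewrite ln_1; lra.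
move: h; rewrite /ln; case: Rlt_dec => [h'|_ h]; last exact: (Rlt_irrefl 0).
by case: (Rlt_not_le _ _ h' h0).
Qed.

Lemma prime_in_ln (X p : nat) (a b : R) : 0 < ln (INR X) ->
  prime_in (Rpower (INR X) a) (Rpower (INR X) b) p ->
  a * ln (INR X) < ln (INR p) <= b * ln (INR X).
Proof.
move=> hL /andP[p_prime /holdsP[h1 h2]]; rewrite -!(ln_Rpower (INR X)).
have hp := INR_gt0 _ (prime_gt0 p_prime).
split; first by apply: ln_increasing => //; apply: exp_pos.
exact: ln_le.
Qed.

(** On [(X^a, X^b]] the factor [ln p] lies between [a * ln X] and [b * ln X]. *)
Lemma recip_bounds (X : nat) (a b : R) : 0 < ln (INR X) -> 0 < a <= b -> b <= 1 ->
  (b - a - 10 / ln (INR X)) / b <= recip X a b <= (b - a + 10 / ln (INR X)) / a.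
Proof.
move=> hL hab hb; set L := ln (INR X) in hL *.
have hX := ln_gt0_R _ hL.
have [] := mertens_interval X (Rpower (INR X) a) (Rpower (INR X) b).
- split; first by apply: Rpower_ge1; lra.
  by apply: Rle_Rpower; lra.
- exact: Rpower_le_self.
rewrite !ln_Rpower -/L => hlo hhi; split.
  apply: (Rmult_le_reg_l (b * L)); first nra.
  have -> : b * L * ((b - a - 10 / L) / b) = b * L - a * L - 10.
    by field; lra.
  apply: (Rle_trans _ _ _ hlo); rewrite /recip big_distrr /=.
  apply: rsum_nat_le => p _ hp; have [_ h] := prime_in_ln _ _ _ _ hL hp.
  apply: Rmult_le_compat_r => //; apply: Rlt_le; apply: Rinv_0_lt_compat.
  by case/andP: hp => /prime_gt0 /INR_gt0.
apply: (Rmult_le_reg_l (a * L)); first nra.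
have -> : a * L * ((b - a + 10 / L) / a) = b * L - a * L + 10.
  by field; lra.
apply: Rle_trans hhi; rewrite /recip big_distrr /=.
apply: rsum_nat_le => p _ hp; have [h _] := prime_in_ln _ _ _ _ hL hp.
apply: Rmult_le_compat_r; last exact: Rlt_le.
apply: Rlt_le; apply: Rinv_0_lt_compat.
by case/andP: hp => /prime_gt0 /INR_gt0.
Qed.

Lemma rsum_prime_in_split (X : nat) (u v w : R) (F : nat -> R) : u <= v <= w ->
  \rsum_(1 <= p < X.+1 | prime_in u w p) F p =
  \rsum_(1 <= p < X.+1 | prime_in u v p) F p +
  \rsum_(1 <= p < X.+1 | prime_in v w p) F p.
Proof.
move=> huvw; rewrite (bigID (fun p => holds (INR p <= v))) /=; congr (_ + _).
  apply: eq_bigl => p; rewrite /prime_in; case: (prime p) => //=.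
  apply/andP/holdsP => [[/holdsP h /holdsP h']|h]; first lra.
  by split; apply/holdsP; lra.
apply: eq_bigl => p; rewrite /prime_in; case: (prime p) => //=.
apply/andP/holdsP => [[/holdsP h /holdsP h']|h]; first lra.
by split; apply/holdsP; lra.
Qed.

(** Mertens' second theorem.  Cutting [[a, b]] into [K] equal pieces, the bounds
    of [recip_bounds] are Riemann sums of [1 / t]; on each piece they differ from
    the increment of [ln] by at most [e], which collects the square of the
    relative mesh and the [O(1 / ln X)] of Mertens' theorem. *)
Lemma recip_cvg (a b eta : R) : 0 < a <= b -> b <= 1 -> 0 < eta ->
  eventually (fun X => Rabs (recip X a b - ln (b / a)) <= eta).
Proof.
move=> hab hb heta.
have ha2 : 0 < a * a * eta by apply: Rmult_lt_0_compat => //; nra.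
have hK' : 0 <= 2 / (a * a * eta) by apply: Rdiv_le_0_compat; lra.
have [K0 [_ hK0]] := nfloor_ex (2 / (a * a * eta)) hK'.
set K := K0.+1; have hK : 2 / (a * a * eta) <= INR K by rewrite S_INR; lra.
have K_gt0 : 0 < INR K by apply: INR_gt0.
apply: filter_imp (eventually_ln_ge (20 * INR K / (a * eta))) => X hLX.
have hae : 0 < a * eta by nra.
have hL : 0 < ln (INR X).
  by apply: Rlt_le_trans hLX; apply: Rdiv_lt_0_compat; lra.
have hX := ln_gt0_R _ hL.
move: hLX; set L := ln (INR X) in hL * => hLX.
set d := (b - a) / INR K; have hd : 0 <= d.
  by apply: Rdiv_le_0_compat; lra.
set e := d * d / (a * a) + 10 / (a * L).
pose t (k : nat) := a + d * INR k.
have tS k : t k.+1 = t k + d by rewrite /t S_INR; ring.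
have t_ge k : a <= t k by rewrite /t; have := pos_INR k; nra.
have step (k : nat) : (k <= K)%N ->
    Rabs (recip X a (t k) - ln (t k / a)) <= INR k * e.
  elim: k => [_|k IH hk].
    have t0 : t 0%N = a by rewrite /t /=; ring.
    rewrite t0 /Rdiv Rinv_r ?ln_1; last lra.
    rewrite /recip big1 => [|p /andP[_ /holdsP]]; last lra.
    by rewrite /= Rminus_0_r Rabs_R0; lra.
  have {}IH := IH (ltnW hk).
  have htk : t k.+1 <= 1.
    apply: Rle_trans hb; rewrite /t.
    have -> : b = a + d * INR K by rewrite /d; field; lra.
    by have := INR_leq _ _ hk; nra.
  have hRp x y : x <= y -> Rpower (INR X) x <= Rpower (INR X) y.
    by move=> h; apply: Rle_Rpower; lra.
  have h0 := t_ge k.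
  have hsplit : recip X a (t k.+1) = recip X a (t k) + recip X (t k) (t k.+1).
    by apply: rsum_prime_in_split; split; apply: hRp; rewrite ?tS; lra.
  have hb2 := recip_bounds X (t k) (t k.+1) hL ltac:(rewrite tS; lra) htk.
  rewrite -/L in hb2; rewrite hsplit.
  have -> : ln (t k.+1 / a) = ln (t k / a) + ln (t k.+1 / t k).
    by rewrite -ln_mult; [congr ln; field; lra | | ]; apply: Rdiv_lt_0_compat;
       rewrite ?tS; lra.
  have hln1 : ln (t k.+1 / t k) <= d / t k.
    have := ln_le_sub1 (t k.+1 / t k); rewrite tS => h.
    have : 0 < (t k + d) / t k by apply: Rdiv_lt_0_compat; lra.
    move/h; have -> : (t k + d) / t k - 1 = d / t k by field; lra.
    by [].
  have hln2 : d / t k.+1 <= ln (t k.+1 / t k).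
    have := ln_ge_1_inv (t k.+1 / t k); rewrite tS => h.
    have : 0 < (t k + d) / t k by apply: Rdiv_lt_0_compat; lra.
    move/h; have -> : 1 - 1 / ((t k + d) / t k) = d / (t k + d) by field; lra.
    by [].
  have hdiff : d / t k - d / t k.+1 <= d * d / (a * a).
    rewrite tS; have -> : d / t k - d / (t k + d) = d * d * / (t k * (t k + d)).
      by field; lra.
    apply: Rmult_le_compat_l; first nra.
    by apply: Rinv_le_contravar; nra.
  have h10 x : a <= x -> 10 / L / x <= 10 / (a * L).
    move=> hx; have -> : 10 / L / x = 10 * / (x * L) by field; lra.
    apply: Rmult_le_compat_l; first lra.
    by apply: Rinv_le_contravar; nra.
  have h10k := h10 _ (t_ge k); have h10k1 := h10 _ (t_ge k.+1).
  have E1 : (t k.+1 - t k + 10 / L) / t k = d / t k + 10 / L / t k.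
    by rewrite tS; field; lra.
  have E2 : (t k.+1 - t k - 10 / L) / t k.+1 = d / t k.+1 - 10 / L / t k.+1.
    by rewrite tS; field; lra.
  rewrite E1 E2 in hb2; case: hb2 => hb3 hb4.
  have he : e = d * d / (a * a) + 10 / (a * L) by [].
  have [h5 h6] := (Rabs_le_between _ _).1 IH.
  by rewrite S_INR Rmult_plus_distr_r; apply: Rabs_le; lra.
have tK : t K = b by rewrite /t /d; field; lra.
have := step K (leqnn _); rewrite tK => h; apply: (Rle_trans _ _ _ h).
have -> : INR K * e = (b - a) * (b - a) / (a * a * INR K) + 10 * INR K / (a * L).
  by rewrite /e /d; field; lra.
have h1 : (b - a) * (b - a) / (a * a * INR K) <= eta / 2.
  apply: (Rmult_le_reg_r (a * a * INR K)); first nra.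
  have -> : (b - a) * (b - a) / (a * a * INR K) * (a * a * INR K)
    = (b - a) * (b - a) by field; lra.
  have : 2 / (a * a * eta) * (a * a * eta) <= INR K * (a * a * eta).
    by apply: Rmult_le_compat_r; lra.
  have -> : 2 / (a * a * eta) * (a * a * eta) = 2 by field; lra.
  by move=> h2; nra.
have h2 : 10 * INR K / (a * L) <= eta / 2.
  apply: (Rmult_le_reg_r (a * L)); first nra.
  have -> : 10 * INR K / (a * L) * (a * L) = 10 * INR K by field; lra.
  have : 20 * INR K / (a * eta) * (a * eta) <= L * (a * eta).
    by apply: Rmult_le_compat_r; lra.
  have -> : 20 * INR K / (a * eta) * (a * eta) = 20 * INR K by field; lra.
  by move=> h3; nra.
lra.
Qed.

Lemma eventually_True (Q : nat -> Prop) : (forall X, Q X) -> eventually Q.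
Proof. by move=> h; exists 0%N => X _. Qed.

Lemma rsum_ge_term (n c : nat) (F : nat -> R) :
  (c < n)%N -> (forall i, 0 <= F i) -> F c <= \rsum_(0 <= i < n) F i.
Proof.
move=> + hF; elim: n => // n IH hc; rewrite big_nat_recr //=.
have h0 : 0 <= \rsum_(0 <= i < n) F i by apply: rsum_nat_ge0.
have [->|hcn] := eqVneq c n; first lra.
by have := IH ltac:(lia); have := hF n; lra.
Qed.

(** * Bad integers and the picking of prime factors

    The exponent interval [[0, 1]] is cut into [N = 2 * P] cells of equal length,
    so that [P] stands for the exponent [1 / 2] and [j] for [a = j / N]. *)

Section Cells.
Variable P : nat.
Hypothesis P_gt0 : (0 < P)%N.
Let N := (2 * P)%N.

Let N_gt0 : 0 < INR N.
Proof. by apply: INR_gt0; rewrite /N; lia. Qed.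

Definition level (X i : nat) : R := Rpower (INR X) (INR i / INR N).

(** Cells are open on the left: the product of a nonempty list of primes is then
    strictly above the product of the lower ends. *)
Definition in_cell (X c p : nat) : bool := prime_in (level X c) (level X c.+1) p.

(** [cs] lists the cells of the primes [ps] picked so far, latest first. *)
Definition matches (X : nat) (cs ps : seq nat) : bool := all2 (in_cell X) cs ps.

Definition prods (ps : seq nat) : nat := foldr muln 1%N ps.

(** The integers whose density was called [F(j / N)] above. *)
Definition bad (X j n : nat) : Prop :=
  (forall p, prime p -> p %| n -> INR p < level X j) /\
  ~ exists d, d %| n /\ level X j <= INR d <= level X (N - j).

(** A number in [(X^(l / N), X^((l + e) / N)]] lies in the window of [j] as soon as
    [j <= l] and [l + e <= N - j], that is, [max (P - l) (l + e - P) <= P - j].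
    [gap_shift cs e s] is the least value of this maximum over the sums [l] of
    [s] with some of the cells of [cs], each of which widens the interval by
    one more cell. *)
Fixpoint gap_shift (cs : seq nat) (e s : nat) : nat :=
  match cs with
  | [::] => maxn (P - s) (s + e - P)
  | c :: cs' => minn (gap_shift cs' e s) (gap_shift cs' e.+1 (s + c))
  end.

(** The same minimum over the nonempty sums of cells, so that some product of the
    picked primes lies in the window of every [j <= P - gap cs]: the values of
    [j] that remain possible are the [gap cs] last ones. *)
Fixpoint gap (cs : seq nat) : nat :=
  match cs with
  | [::] => P
  | c :: cs' => minn (gap cs') (gap_shift cs' 1 c)
  end.

Lemma gap_le (cs : seq nat) : (gap cs <= P)%N.
Proof. by elim: cs => //= c cs IH; rewrite geq_min IH. Qed.

Lemma levelD (X i j : nat) : level X (i + j) = level X i * level X j.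
Proof.
by rewrite /level -Rpower_plus; congr Rpower; rewrite INR_addn; field; lra.
Qed.

Lemma level_gt0 (X i : nat) : 0 < level X i.
Proof. exact: exp_pos. Qed.

Lemma level0 (X : nat) : 1 < INR X -> level X 0 = 1.
Proof. by move=> hX; rewrite /level /= /Rdiv Rmult_0_l Rpower_O //; lra. Qed.

Lemma levelN (X : nat) : 1 < INR X -> level X N = INR X.
Proof. by move=> hX; rewrite /level /Rdiv Rinv_r ?Rpower_1 //; lra. Qed.

Lemma level_mono (X i j : nat) : 1 < INR X -> (i <= j)%N -> level X i <= level X j.
Proof.
move=> hX hij; apply: Rle_Rpower; first lra.
by apply: Rmult_le_compat_r; [apply: Rlt_le; apply: Rinv_0_lt_compat | apply: INR_leq].
Qed.

Lemma in_cellP (X c p : nat) :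
  in_cell X c p -> [/\ prime p, level X c < INR p & INR p <= level X c.+1].
Proof. by case/andP=> hp /holdsP[]. Qed.

Lemma gap_shift_window (X j : nat) (cs ps : seq nat) (e s q : nat) :
  1 < INR X -> (j <= P)%N -> matches X cs ps ->
  level X s <= INR q <= level X (s + e) -> (gap_shift cs e s <= P - j)%N ->
  exists2 d, d %| prods ps & level X j <= INR (q * d)%N <= level X (N - j).
Proof.
move=> hX hj; elim: cs ps e s q => [|c cs IH] [|p ps] //= e s q.
  move=> _ hq; rewrite geq_max => /andP[h1 h2]; exists 1%N => //; rewrite muln1.
  have := level_mono X j s hX ltac:(lia).
  have := level_mono X (s + e) (N - j) hX ltac:(rewrite /N; lia); lra.
case/andP=> hp hps hq; rewrite geq_min => /orP[h|h].
  have [d hd hw] := IH ps e s q hps hq h.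
  by exists d => //; apply: dvdn_mull.
have [p_prime hp1 hp2] := in_cellP _ _ _ hp.
have hqp : level X (s + c) <= INR (q * p)%N <= level X (s + c + e.+1).
  rewrite (_ : s + c + e.+1 = s + e + c.+1)%N; last lia.
  rewrite !levelD INR_muln; have := level_gt0 X s; have := level_gt0 X c.
  by move=> h1 h2; split; apply: Rmult_le_compat; rewrite -?levelD; lra.
have [d hd hw] := IH ps e.+1 (s + c)%N (q * p)%N hps hqp h.
by exists (p * d)%N; [apply: dvdn_mul | rewrite mulnA].
Qed.

Lemma gap_window (X j : nat) (cs ps : seq nat) :
  1 < INR X -> (0 < j <= P)%N -> matches X cs ps -> (gap cs <= P - j)%N ->
  exists2 d, d %| prods ps & level X j <= INR d <= level X (N - j).
Proof.
move=> hX hj; elim: cs ps => [|c cs IH] [|p ps] //=; first lia.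
case/andP=> hp hps; rewrite geq_min => /orP[h|h].
  have [d hd hw] := IH ps hps h.
  by exists d => //; apply: dvdn_mull.
have [p_prime hp1 hp2] := in_cellP _ _ _ hp.
have hq : level X c <= INR p <= level X (c + 1) by rewrite addn1; lra.
have [d hd hw] := gap_shift_window X j cs ps 1 c p hX ltac:(lia) hps hq h.
by exists (p * d)%N => //; apply: dvdn_mul.
Qed.

Lemma prods_le (X : nat) (cs ps : seq nat) : 1 < INR X -> matches X cs ps ->
  INR (prods ps) <= level X (sumn cs + size cs).
Proof.
move=> hX; elim: cs ps => [|c cs IH] [|p ps] //=; first by rewrite level0 //; lra.
case/andP=> /in_cellP[p_prime hp1 hp2] /IH h.
rewrite INR_muln (_ : c + sumn cs + (size cs).+1 = c.+1 + (sumn cs + size cs))%N; last lia.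
by rewrite levelD; apply: Rmult_le_compat => //; apply: pos_INR.
Qed.

Lemma prods_ge (X : nat) (cs ps : seq nat) : 1 < INR X -> matches X cs ps ->
  level X (sumn cs) <= INR (prods ps).
Proof.
move=> hX; elim: cs ps => [|c cs IH] [|p ps] //=; first by rewrite level0 //; lra.
case/andP=> /in_cellP[p_prime hp1 hp2] /IH h.
rewrite INR_muln levelD; have := level_gt0 X c; have := level_gt0 X (sumn cs).
by move=> h1 h2; apply: Rmult_le_compat; lra.
Qed.

Lemma prods_gt (X c : nat) (cs ps : seq nat) : 1 < INR X -> matches X (c :: cs) ps ->
  level X (sumn (c :: cs)) < INR (prods ps).
Proof.
move=> hX; case: ps => [|p ps] //= /andP[/in_cellP[p_prime hp1 hp2]].
move=> /(prods_ge _ _ _ hX) h; rewrite INR_muln levelD.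
have h1 := level_gt0 X c; have h2 := level_gt0 X (sumn cs).
apply: (Rle_lt_trans _ (level X c * INR (prods ps))).
  by apply: Rmult_le_compat_l; lra.
by apply: Rmult_lt_compat_r; lra.
Qed.

Lemma prods_gt0 (X : nat) (cs ps : seq nat) : matches X cs ps -> (0 < prods ps)%N.
Proof.
elim: cs ps => [|c cs IH] [|p ps] //= /andP[/in_cellP[/prime_gt0 p_gt0 _ _] /IH h].
by rewrite muln_gt0 p_gt0.
Qed.

Definition bad_count (X j d : nat) : R :=
  \rsum_(1 <= m < (X %/ d).+1 | holds (bad X j (d * m)%N)) 1.

(** Among the multiples of the product of primes picked in the cells [cs], a
    proportion at most [beta] is bad, uniformly in the primes. *)
Definition bad_density_le (j : nat) (cs : seq nat) (beta : R) : Prop :=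
  eventually (fun X => forall ps, matches X cs ps ->
    bad_count X j (prods ps) <= beta * (INR X / INR (prods ps))).

Lemma bad_density_le1 (j : nat) (cs : seq nat) : bad_density_le j cs 1.
Proof.
apply: eventually_True => X ps hps; have d_gt0 := prods_gt0 _ _ _ hps.
rewrite Rmult_1_l; apply: (Rle_trans _ (INR (X %/ prods ps))).
  rewrite -[INR (X %/ _)]Rmult_1_r -rsum_nat_const.
  by apply: rsum_nat_sub => // *; lra.
exact: INR_divn_le.
Qed.

Lemma bad_density_mono (j : nat) (cs : seq nat) (b b' : R) :
  b <= b' -> bad_density_le j cs b -> bad_density_le j cs b'.
Proof.
move=> hb; apply: filter_imp => X h ps hps; apply: (Rle_trans _ _ _ (h ps hps)).
apply: Rmult_le_compat_r => //; apply: Rdiv_le_0_compat; first exact: pos_INR.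
exact: INR_gt0 (prods_gt0 _ _ _ hps).
Qed.

Lemma bad_density_hit (j : nat) (cs : seq nat) :
  (0 < j <= P)%N -> (gap cs <= P - j)%N -> bad_density_le j cs 0.
Proof.
move=> hj hgap; apply: filter_imp eventually_gt1 => X hX ps hps.
rewrite Rmult_0_l /bad_count big1 => [|m /holdsP[_ []]]; first lra.
have [d hd hw] := gap_window X j cs ps hX hj hps hgap.
by exists d; split => //; apply: dvdn_mulr.
Qed.

(** The picked primes have a product larger than [X]. *)
Lemma bad_density_over (j c : nat) (cs : seq nat) :
  (N <= c + sumn cs)%N -> bad_density_le j (c :: cs) 0.
Proof.
move=> hN; apply: filter_imp eventually_gt1 => X hX ps hps.
have h1 := prods_gt _ _ _ _ hX hps; have h2 := level_mono X N _ hX hN.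
rewrite levelN // in h2.
have hlt : (X < prods ps)%N.
  by rewrite ltnNge; apply/negP => /INR_leq; move: h1; rewrite /=; lra.
by rewrite /bad_count divn_small // big_geq //; lra.
Qed.

Lemma in_cell_exists (X j p : nat) : 1 < INR X -> prime p -> INR p <= level X j ->
  exists2 c, (c < j)%N & in_cell X c p.
Proof.
move=> hX p_prime; have hp := prime_ge2 _ p_prime.
elim: j => [|j IH]; first by rewrite level0 //; lra.
case: (Rle_or_lt (INR p) (level X j)) => [/IH[c hc hcp] _|h1 h2].
  by exists c => //; lia.
by exists j => //; rewrite /in_cell /prime_in p_prime; apply/holdsP.
Qed.

Lemma cell_mertens (X c : nat) : 1 < INR X -> (c < N)%N ->
  \rsum_(1 <= p < X.+1 | in_cell X c p) (ln (INR p) / INR p)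
    <= ln (INR X) / INR N + 10.
Proof.
move=> hX hc; have [] := mertens_interval X (level X c) (level X c.+1).
- by split; [rewrite -(level0 X) //|]; apply: level_mono.
- by rewrite -[X in _ <= X](levelN X) //; apply: level_mono.
move=> _; rewrite !ln_Rpower S_INR => h; apply: (Rle_trans _ _ _ h).
by apply: Req_le; field; lra.
Qed.

(** One pick, for a fixed [X].  Cofactors [m <= X^u] are counted trivially; the
    others have [ln m >= u * ln X], so that
    [sum_ln_le_prime_factors] bounds their number by a sum over the next prime
    [p].  Such a [p] divides a bad number, hence lies in a cell below [j], and by
    Mertens' theorem each cell has weight [ln X / N + O(1)]. *)
Lemma bad_count_step (X j : nat) (cs ps : seq nat) (b : nat -> R) (u : R) :
  1 < INR X -> (j <= P)%N -> matches X cs ps -> 0 < u ->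
  (forall c, 0 <= b c) ->
  (forall c qs, (c < P)%N -> matches X (c :: cs) qs ->
    bad_count X j (prods qs) <= b c * (INR X / INR (prods qs))) ->
  u * ln (INR X) * bad_count X j (prods ps) <=
    INR X / INR (prods ps) *
      ((\rsum_(0 <= c < P) b c) * (ln (INR X) / INR N + 10) + 2)
    + u * ln (INR X) * Rpower (INR X) u.
Proof.
move=> hX hj hps hu hb IH; set d := prods ps; set L := ln (INR X).
have hL : 0 < L by rewrite /L -ln_1; apply: ln_increasing; lra.
have d_gt0 : (0 < d)%N := prods_gt0 _ _ _ hps.
have hd := INR_gt0 _ d_gt0; set Y := (X %/ d)%N.
pose B m := holds (bad X j (d * m)%N).
have h1 : u * L * bad_count X j d <=
    \rsum_(1 <= m < Y.+1 | B m) ln (INR m) + u * L * Rpower (INR X) u.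
  rewrite /bad_count big_distrr /= -/Y.
  apply: (Rle_trans _ (\rsum_(1 <= m < Y.+1 | B m)
    (ln (INR m) + if holds (INR m <= Rpower (INR X) u) then u * L else 0))).
    apply: rsum_nat_le => m hm _; case: holdsP => h; have := ln_ge0 m; first lra.
    move=> _; rewrite Rmult_1_r Rplus_0_r /L -ln_Rpower; apply: ln_le.
      exact: exp_pos.
    exact: Rlt_le (Rnot_le_lt _ _ h).
  rewrite big_split /=; apply: Rplus_le_compat_l.
  have huL : 0 <= u * L by nra.
  apply: (Rle_trans _ (u * L * \rsum_(1 <= m < Y.+1 |
      holds (INR m <= Rpower (INR X) u)) 1)).
    rewrite big_distrr /= [X in X <= _]big_mkcond [X in _ <= X]big_mkcond /=.
    by apply: rsum_nat_le => m _ _; case: (B m); case: ifP => _; lra.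
  apply: Rmult_le_compat_l => //; apply: count_le_real.
    exact: Rlt_le (exp_pos _).
  by move=> m _ /holdsP.
apply: (Rle_trans _ _ _ h1); apply: Rplus_le_compat_r.
apply: (Rle_trans _ _ _ (sum_ln_le_prime_factors B Y)).
have hYX : INR Y <= INR X / INR d by apply: INR_divn_le.
rewrite Rmult_plus_distr_l; apply: Rplus_le_compat; last lra.
apply: (Rle_trans _ (\rsum_(0 <= c < P) \rsum_(1 <= p < Y.+1 | in_cell X c p)
   (b c * (INR X / INR d) * (ln (INR p) / INR p)))).
  have hterm (p : nat) (c : nat) : (c < P)%N -> in_cell X c p ->
      ln (INR p) * \rsum_(1 <= k < (Y %/ p).+1 | B (p * k)%N) 1 <=
      b c * (INR X / INR d) * (ln (INR p) / INR p).
    move=> hc hcp; have [p_prime _ _] := in_cellP _ _ _ hcp.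
    have hp := prime_ge2 _ p_prime.
    have := IH c (p :: ps) hc; rewrite /= hcp => /(_ hps); rewrite -/d.
    rewrite /bad_count INR_muln /Y -divnMA (mulnC d p).
    rewrite (eq_bigl (fun k => B (p * k)%N)); last first.
      by move=> k; rewrite /B; congr holds; rewrite mulnA (mulnC d p).
    move=> h; have hl := ln_ge0 p.
    have -> : b c * (INR X / INR d) * (ln (INR p) / INR p) =
       ln (INR p) * (b c * (INR X / (INR p * INR d))) by field; lra.
    exact: Rmult_le_compat_l.
  under [X in _ <= X]eq_bigr => c _ do rewrite big_mkcond /=.
  rewrite [X in _ <= X]exchange_big /= [X in X <= _]big_mkcond /=.
  apply: rsum_nat_le => p hp _.
  have hge0 c : 0 <= (if in_cell X c p then
      b c * (INR X / INR d) * (ln (INR p) / INR p) else 0).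
    case: ifP => _; last lra.
    have hp0 : 0 < INR p by apply: INR_gt0; lia.
    apply: Rmult_le_pos; last by apply: Rdiv_le_0_compat => //; apply: ln_ge0.
    by apply: Rmult_le_pos => //; apply: Rdiv_le_0_compat => //; apply: pos_INR.
  case: ifP => p_prime; last by apply: rsum_nat_ge0 => c _ _; apply: hge0.
  case: (Rle_or_lt (INR p) (level X j)) => hpj; last first.
    rewrite big1 => [|k /holdsP[hk _]].
      by rewrite Rmult_0_r; apply: rsum_nat_ge0 => c _ _; apply: hge0.
    have := hk p p_prime (dvdn_mull _ (dvdn_mulr _ (dvdnn p))); lra.
  have [c hc hcp] := in_cell_exists _ _ _ hX p_prime hpj.
  have hcP : (c < P)%N by lia.
  apply: (Rle_trans _ _ _ (hterm p c hcP hcp)).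
  by have := rsum_ge_term P c _ hcP hge0; rewrite hcp.
rewrite [X in _ <= _ * X]big_distrl /= big_distrr /=.
apply: rsum_nat_le => c hc _; rewrite -big_distrr /=.
have hXd : 0 <= INR X / INR d by apply: Rdiv_le_0_compat => //; apply: pos_INR.
rewrite (Rmult_comm (b c)) Rmult_assoc; apply: Rmult_le_compat_l => //.
apply: Rmult_le_compat_l => //; apply: Rle_trans (cell_mertens X c hX _); last first.
  by rewrite /N; lia.
apply: rsum_nat_widen; first by rewrite ltnS /Y leq_div.
move=> p hp _; apply: Rdiv_le_0_compat; first exact: ln_ge0.
by apply: INR_gt0; lia.
Qed.

Lemma eventually_forall_lt (n : nat) (Q : nat -> nat -> Prop) :
  (forall c, (c < n)%N -> eventually (Q c)) ->
  eventually (fun X => forall c, (c < n)%N -> Q c X).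
Proof.
elim: n => [|n IH] h; first by apply: eventually_True.
have h1 := IH (fun c hc => h c (ltnW hc)); have h2 := h n (leqnn _).
apply: filter_imp (filter_and _ _ h1 h2) => X [h3 h4] c hc.
by have [->//|hcn] := eqVneq c n; apply: h3; lia.
Qed.

(** The cofactor of the picked primes is about [X^q], where [q * N] is the
    number of cells left, and the next exponent is uniform over these cells: the
    proportion of bad numbers is at most the average of the proportions after
    the next pick. *)
Lemma bad_density_step (j : nat) (cs : seq nat) (b : nat -> R) (beta : R) :
  (j <= P)%N -> (sumn cs + size cs < N)%N -> (forall c, 0 <= b c) ->
  (forall c, (c < P)%N -> bad_density_le j (c :: cs) (b c)) ->
  \rsum_(0 <= c < P) b c < INR (N - (sumn cs + size cs)) * beta ->
  bad_density_le j cs beta.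
Proof.
move=> hj hN hb hUB; set r := (N - _)%N; set S := bigop _ _ _ => hS.
have hr : 0 < INR r by apply: INR_gt0; rewrite /r; lia.
have S_ge0 : 0 <= S by apply: rsum_nat_ge0.
have beta_gt0 : 0 < beta by nra.
set q := INR r / INR N; have q_gt0 : 0 < q by apply: Rdiv_lt_0_compat.
have hSN : S / INR N < q * beta.
  apply: (Rmult_lt_reg_r (INR N)) => //; rewrite /q.
  have -> : S / INR N * INR N = S by field; lra.
  by have -> : INR r / INR N * beta * INR N = INR r * beta by field; lra.
(* Half of the room left by the strict inequality between the average and [beta]. *)
set eps := (q - S / INR N / beta) / 2.
have hSb : S / INR N / beta < q.
  apply: (Rmult_lt_reg_r beta) => //.
  by have -> : S / INR N / beta * beta = S / INR N by field; lra.
have hSb0 : 0 <= S / INR N / beta by do 2!apply: Rdiv_le_0_compat => //.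
have eps_gt0 : 0 < eps by rewrite /eps; lra.
have u_gt0 : 0 < q - eps by rewrite /eps; lra.
set kappa := (q * beta - S / INR N) / 2.
have kappa_gt0 : 0 < kappa by rewrite /kappa; lra.
have hkappa : (q - eps) * beta = S / INR N + kappa.
  by rewrite /eps /kappa; field; lra.
set K := 10 * S + 2 + (q - eps) / eps.
apply: filter_imp (filter_and _ _ eventually_gt1 (filter_and _ _
  (eventually_ln_ge (K / kappa)) (eventually_forall_lt P _ hUB))) => X [hX [hLX IH]] ps hps.
have step := bad_count_step X j cs ps b (q - eps) hX hj hps u_gt0 hb
  (fun c qs hc hqs => IH c hc qs hqs).
rewrite -/S in step; set L := ln (INR X) in step hLX.
have hL : 0 < L by rewrite /L -ln_1; apply: ln_increasing; lra.
set Z := INR X / INR (prods ps) in step *.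
have hd := INR_gt0 _ (prods_gt0 _ _ _ hps).
have hZ : Rpower (INR X) q <= Z.
  have h := prods_le _ _ _ hX hps.
  apply: (Rmult_le_reg_r (INR (prods ps))) => //.
  have -> : Z * INR (prods ps) = INR X by rewrite /Z; field; lra.
  apply: (Rle_trans _ (Rpower (INR X) q * level X (sumn cs + size cs))).
    by apply: Rmult_le_compat_l => //; apply: Rlt_le; apply: exp_pos.
  rewrite /q -/(level X r) -levelD (_ : r + _ = N)%N ?levelN //; first lra.
  by rewrite /r; lia.
have hpow : Rpower (INR X) (q - eps) <= Z / (eps * L).
  have -> : Rpower (INR X) (q - eps) = Rpower (INR X) q * / exp (eps * L).
    by rewrite /Rminus Rpower_plus {2}/Rpower -exp_Ropp; congr (_ * exp _);
       rewrite -/L; ring.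
  apply: Rmult_le_compat => //.
  - exact: Rlt_le (exp_pos _).
  - by apply: Rlt_le; apply: Rinv_0_lt_compat; apply: exp_pos.
  apply: Rinv_le_contravar; first nra.
  by have := exp_ineq1_le (eps * L); lra.
have hZ0 : 0 < Z by apply: Rlt_le_trans hZ; apply: exp_pos.
apply: (Rmult_le_reg_l ((q - eps) * L)); first nra.
apply: (Rle_trans _ _ _ step).
apply: (Rle_trans _ (Z * (S * (L / INR N + 10) + 2) + Z * ((q - eps) / eps))).
  apply: Rplus_le_compat_l.
  apply: (Rle_trans _ ((q - eps) * L * (Z / (eps * L)))).
    by apply: Rmult_le_compat_l => //; nra.
  by apply: Req_le; field; lra.
rewrite -Rmult_plus_distr_l.
have -> : (q - eps) * L * (beta * Z) = Z * ((q - eps) * beta * L) by ring.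
apply: Rmult_le_compat_l; first lra.
rewrite hkappa.
have : K <= kappa * L.
  have : K / kappa * kappa <= L * kappa by apply: Rmult_le_compat_r; lra.
  have -> : K / kappa * kappa = K by field; lra.
  lra.
rewrite /K => hK.
have -> : S * (L / INR N + 10) + 2 + (q - eps) / eps
   = S / INR N * L + (10 * S + 2 + (q - eps) / eps) by field; lra.
lra.
Qed.

End Cells.

(** * The sum over all picks *)

Section Tree.
Variable P : nat.
Hypothesis P_gt0 : (0 < P)%N.
Let N := (2 * P)%N.

Definition room (cs : seq nat) : nat := N - (sumn cs + size cs).

(** Bound for the proportion of bad numbers obtained from at most [n] further
    picks.  The trivial bound [alive] is kept whenever picking makes things
    worse, which happens when little room is left. *)
Fixpoint pick_bound (j n : nat) (cs : seq nat) : R :=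
  let alive := if (P < j + gap P cs)%N then 1 else 0 in
  match n with
  | O => alive
  | S n' =>
      if room cs == 0%N then alive else
      Rmin alive
        ((\rsum_(0 <= c < P)
            (if (N <= c + sumn cs)%N then 0 else pick_bound j n' (c :: cs)))
         / INR (room cs))
  end.

(** The recursion of [pick_bound] summed over [j]: the indicators add up to the
    gap. *)
Fixpoint gap_bound (n : nat) (cs : seq nat) : R :=
  match n with
  | O => INR (gap P cs)
  | S n' =>
      if room cs == 0%N then INR (gap P cs) else
      Rmin (INR (gap P cs))
        ((\rsum_(0 <= c < P)
            (if (N <= c + sumn cs)%N then 0 else gap_bound n' (c :: cs)))
         / INR (room cs))
  end.

Lemma room_gt0 (cs : seq nat) : room cs != 0%N -> 0 < INR (room cs).
Proof. by rewrite -lt0n => /INR_gt0. Qed.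

Lemma pick_bound_ge0 (j n : nat) (cs : seq nat) : 0 <= pick_bound j n cs.
Proof.
elim: n cs => [|n IH] cs /=; first by case: ifP => _; lra.
case: eqP => [_|/eqP/room_gt0 hr]; first by case: ifP => _; lra.
apply: Rmin_glb; first by case: ifP => _; lra.
apply: Rdiv_le_0_compat => //; apply: rsum_nat_ge0 => c _ _.
by case: ifP => // _; lra.
Qed.

Lemma bad_density_pick_bound (j n : nat) (cs : seq nat) (eta : R) :
  (0 < j <= P)%N -> 0 < eta -> bad_density_le P j cs (pick_bound j n cs + eta).
Proof.
move=> hj; elim: n cs eta => [|n IH] cs eta heta.
  rewrite /=; case: ifP => h.
    by apply: bad_density_mono (bad_density_le1 P j cs); lra.
  apply: bad_density_mono (bad_density_hit P P_gt0 j cs hj _); [lra | lia].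
have halive : bad_density_le P j cs
    ((if (P < j + gap P cs)%N then 1 else 0) + eta).
  case: ifP => h.
    by apply: bad_density_mono (bad_density_le1 P j cs); lra.
  by apply: bad_density_mono (bad_density_hit P P_gt0 j cs hj _); [lra | lia].
rewrite /=; case: eqP => // /eqP hr; have hr0 := room_gt0 _ hr.
rewrite /Rmin; case: Rle_dec => // _.
have hPR : 0 < INR P by apply: INR_gt0.
(* Spreads half of the margin [eta] evenly over the [P] next cells. *)
pose e := eta * INR (room cs) / (2 * INR P).
have he : 0 < e by apply: Rdiv_lt_0_compat; nra.
pose b c := (if (N <= c + sumn cs)%N then 0 else pick_bound j n (c :: cs)) + e.
apply: (bad_density_step P P_gt0 j cs b); first lia.
- by move: hr; rewrite /room /N; lia.
- move=> c; rewrite /b; have := pick_bound_ge0 j n (c :: cs).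
  by case: ifP => _; lra.
- move=> c hc; rewrite /b; case: ifP => hN; last exact: IH.
  by apply: bad_density_mono (bad_density_over P P_gt0 j c cs hN); lra.
rewrite /b big_split /= rsum_const count_predT size_iota subn0 -/(room cs).
set S := bigop _ _ _.
have -> : INR P * e = eta * INR (room cs) / 2 by rewrite /e; field; lra.
rewrite Rmult_plus_distr_l.
have -> : INR (room cs) * (S / INR (room cs)) = S by field; lra.
nra.
Qed.

Lemma sum_alive (g n : nat) : (g <= P)%N ->
  \rsum_(1 <= j < n.+1) (if (P < j + g)%N then 1 else 0) = INR (n + g - P).
Proof.
move=> hg; elim: n => [|n IH]; first by rewrite big_geq // (_ : 0 + g - P = 0)%N //; lia.
rewrite big_nat_recr //= IH; case: ifP => h.
  by rewrite (_ : n.+1 + g - P = (n + g - P).+1)%N; [rewrite S_INR | lia].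
have -> : (n.+1 + g - P = 0)%N by lia.
have -> : (n + g - P = 0)%N by lia.
by rewrite /=; lra.
Qed.

(** The sum over [j] of the indicators of [P - gap < j <= P] is [gap], and a sum
    of minima is at most the minimum of the sums. *)
Lemma sum_pick_bound (n : nat) (cs : seq nat) :
  \rsum_(1 <= j < P.+1) pick_bound j n cs <= gap_bound n cs.
Proof.
have leaf cs' : \rsum_(1 <= j < P.+1) (if (P < j + gap P cs')%N then 1 else 0)
    = INR (gap P cs').
  by rewrite sum_alive ?gap_le // addKn.
elim: n cs => [|n IH] cs; rewrite /= ?leaf; first lra.
case: eqP => [_|/eqP/room_gt0 hr]; first by rewrite leaf; lra.
apply: Rmin_glb.
  by rewrite -leaf; apply: rsum_nat_le => j _ _; apply: Rmin_l.
apply: (Rle_trans _ (\rsum_(1 <= j < P.+1)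
   ((\rsum_(0 <= c < P)
      (if (N <= c + sumn cs)%N then 0 else pick_bound j n (c :: cs)))
     / INR (room cs)))).
  by apply: rsum_nat_le => j _ _; apply: Rmin_r.
rewrite -big_distrl /=; apply: Rmult_le_compat_r.
  by apply: Rlt_le; apply: Rinv_0_lt_compat.
rewrite exchange_big /=; apply: rsum_nat_le => c _ _.
by case: ifP => _; [rewrite big1_eq; lra | apply: IH].
Qed.

(** ** Fixed-point evaluation of [gap_bound]

    The functions [gap_shift cs e] for the [e] that can still be needed are kept
    as tables, which are updated at each pick instead of being recomputed from
    all the subsets of [cs]. *)

Section Evaluation.
Variables (scale : Z) (coarse : nat -> nat).
Hypothesis scale_gt0 : (0 < scale)%Z.

Fixpoint zip_min (l l' : seq nat) : seq nat :=
  match l, l' with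
  | a :: t, b :: t' => Nat.min a b :: zip_min t t'
  | _, _ => [::]
  end.

(** Table of [gap_shift (c :: cs)] from that of [gap_shift cs]. *)
Fixpoint next_tables (c : nat) (Ls : seq (seq nat)) : seq (seq nat) :=
  match Ls with
  | L :: (L' :: _) as Ls' => zip_min L (drop c L') :: next_tables c Ls'
  | _ => [::]
  end.

(** Upper bounds for [scale / k], [scale / (k - 1)], ..., [scale / 1]. *)
Fixpoint inverses (k : nat) : seq Z :=
  match k with
  | O => [::]
  | S k' => (scale / Z.of_nat k + 1)%Z :: inverses k'
  end.

(** Sum of [f] over [k] consecutive cells from [c] on, of which the [m] first ones
    leave a product below [X]; the tables [l] and [iv] are read in step. *)
Fixpoint sweep (f : nat -> nat -> seq Z -> nat -> Z)
    (k c m : nat) (l : seq nat) (iv : seq Z) : Z :=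
  match k, m, l with
  | S k', S m', a :: l' =>
      (f c a iv m + sweep f k' (S c) m' l' (behead iv))%Z
  | _, _, _ => 0%Z
  end.

(** The last pick needs no table of its own, only the gaps it leads to. *)
Fixpoint sweep_last (g k m : nat) (l : seq nat) : nat :=
  match k, m, l with
  | S k', S m', a :: l' => Nat.add (Nat.min g a) (sweep_last g k' m' l')
  | _, _, _ => O
  end.

(** An upper bound for [gap_bound n cs * scale ^ n].  The remaining gap [g] is a
    valid bound at any stage, and is used when it is at most [coarse n], where
    further picks would not gain much. *)
Fixpoint evaluate (n : nat) (Ls : seq (seq nat)) (g : nat) (iv : seq Z)
    (m : nat) : Z :=
  match n with
  | O => Z.of_nat g
  | S n' =>
      let crude := (Z.of_nat g * scale ^ Z.of_nat n)%Z in
      match iv with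
      | [::] => crude
      | w :: iv' =>
          if Nat.leb g (coarse n) then crude else
          Z.min crude (w * match n' with
            | O => Z.of_nat (sweep_last g P m (head [::] Ls))
            | _ => sweep (fun c a iv0 m0 =>
                     evaluate n' (next_tables c Ls) (Nat.min g a) iv0 m0)
                   P 0 m (head [::] Ls) iv'
            end)
      end
  end.

(** The size condition ensures that all the cells below [P] can be looked up at
    each of the [n] picks, as a pick of [c] shortens the tables by [c < P]. *)
Definition tabulates (n : nat) (cs : seq nat) (Ls : seq (seq nat)) : Prop :=
  size Ls = n /\ forall e, (e < n)%N ->
    (n * P <= size (nth [::] Ls e))%N /\
    forall s, (s < size (nth [::] Ls e))%N ->
      nth 0%N (nth [::] Ls e) s = gap_shift P cs e.+1 s.

Lemma minn_min (a b : nat) : Nat.min a b = minn a b.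
Proof. lia. Qed.

Lemma size_zip_min (l l' : seq nat) : size (zip_min l l') = minn (size l) (size l').
Proof. by elim: l l' => [|a l IH] [|b l'] //=; rewrite ?min0n ?minn0 // IH minnSS. Qed.

Lemma nth_zip_min (l l' : seq nat) (s : nat) :
  (s < size l)%N -> (s < size l')%N ->
  nth 0%N (zip_min l l') s = minn (nth 0%N l s) (nth 0%N l' s).
Proof.
elim: l l' s => [|a l IH] [|b l'] [|s] //=; first by rewrite minn_min.
by rewrite !ltnS; apply: IH.
Qed.

Lemma size_next_tables (c : nat) (Ls : seq (seq nat)) :
  size (next_tables c Ls) = (size Ls).-1.
Proof. by elim: Ls => [|L [|L' Ls] IH] //=; rewrite -[(size Ls).+1]/((size (L' :: Ls)).-1.+1) -IH. Qed.

Lemma nth_next_tables (c e : nat) (Ls : seq (seq nat)) : (e.+1 < size Ls)%N ->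
  nth [::] (next_tables c Ls) e =
  zip_min (nth [::] Ls e) (drop c (nth [::] Ls e.+1)).
Proof. by elim: Ls e => [|L [|L' Ls] IH] [|e] //= h; apply: IH. Qed.

Lemma tabulates_next (n c : nat) (cs : seq nat) (Ls : seq (seq nat)) :
  (c < P)%N -> tabulates n.+1 cs Ls -> tabulates n (c :: cs) (next_tables c Ls).
Proof.
move=> hc [hsize h]; split; first by rewrite size_next_tables hsize.
move=> e he; have [h1 h2] := h e ltac:(lia); have [h3 h4] := h e.+1 ltac:(lia).
rewrite nth_next_tables ?hsize // size_zip_min size_drop; split.
  rewrite leq_min; move: h1 h3; rewrite mulSn; lia.
move=> s; rewrite leq_min => /andP[hs1 hs2].
rewrite nth_zip_min ?size_drop // nth_drop h2 // h4; last lia.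
by rewrite /= (addnC c).
Qed.

Lemma gap_bound_le (n : nat) (cs : seq nat) : gap_bound n cs <= INR (gap P cs).
Proof. by case: n => [|n] /=; [lra | case: eqP => _; [lra | apply: Rmin_l]]. Qed.

Lemma behead_inverses (k : nat) : behead (inverses k) = inverses k.-1.
Proof. by case: k. Qed.

Lemma sweep_ge (f : nat -> nat -> seq Z -> nat -> Z) (F : nat -> R)
    (k c m q : nat) (l : seq nat) :
  (k <= size l)%N ->
  (forall i, (i < k)%N -> (i < m)%N ->
    F (c + i)%N <= IZR (f (c + i)%N (nth 0%N l i) (inverses (q - i)) (m - i)%N)) ->
  \rsum_(c <= i < c + k) (if (m + c <= i)%N then 0 else F i)
    <= IZR (sweep f k c m l (inverses q)).
Proof.
elim: k c m q l => [|k IH] c m q l hl hF.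
  by rewrite big_geq /=; [lra | lia].
case: m hF => [|m] hF.
  rewrite big1_seq /=; first lra.
  by move=> i; rewrite mem_index_iota add0n => /andP[-> _].
case: l hl hF => [|a l] //= hl hF.
rewrite plus_IZR big_ltn; last lia.
rewrite (_ : (m.+1 + c <= c)%N = false); last lia.
apply: Rplus_le_compat.
  by have := hF 0%N isT isT; rewrite addn0 !subn0.
rewrite behead_inverses addnS -addSn.
rewrite (eq_big_nat _ _ (F2 := fun i => if (m + c.+1 <= i)%N then 0 else F i)); last first.
  by move=> i _; rewrite addSn addnS.
apply: IH => // i hi hm; have := hF i.+1 hi hm.
by rewrite addnS addSn /= subSS -subn1 -subnDA add1n.
Qed.

Lemma sweep_last_ge (g k c m : nat) (l : seq nat) : (k <= size l)%N ->
  \rsum_(c <= i < c + k) (if (m + c <= i)%N then 0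
                          else INR (minn g (nth 0%N l (i - c))))
    <= INR (sweep_last g k m l).
Proof.
elim: k c m l => [|k IH] c m l hl.
  by rewrite big_geq /=; [lra | lia].
case: m => [|m].
  rewrite big1_seq /=; first lra.
  by move=> i; rewrite mem_index_iota add0n => /andP[-> _].
case: l hl => [|a l] // hl; rewrite [sweep_last _ _ _ _]/= -/addn.
rewrite plus_INR big_ltn; last lia.
rewrite (_ : (m.+1 + c <= c)%N = false); last lia.
apply: Rplus_le_compat; first by rewrite subnn minn_min; apply: Rle_refl.
rewrite addnS -addSn.
rewrite (eq_big_nat _ _ (F2 := fun i => if (m + c.+1 <= i)%N then 0
    else INR (minn g (nth 0%N l (i - c.+1))))); first exact: IH.
move=> i hi; rewrite addSn addnS; case: ifP => // _.
by rewrite (_ : i - c = (i - c.+1).+1)%N; last lia.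
Qed.

Lemma inverse_ge (k : nat) : (0 < k)%N ->
  IZR scale / INR k <= IZR (scale / Z.of_nat k + 1).
Proof.
move=> k_gt0; have hk := INR_gt0 _ k_gt0.
apply: (Rmult_le_reg_r (INR k)) => //.
have -> : IZR scale / INR k * INR k = IZR scale by field; lra.
rewrite [INR k]INR_IZR_INZ -mult_IZR; apply: IZR_le.
have := Z.mul_succ_div_gt scale (Z.of_nat k); lia.
Qed.

Lemma evaluateS (n : nat) (Ls : seq (seq nat)) (g : nat) (w : Z) (iv : seq Z)
    (m : nat) :
  evaluate n.+1 Ls g (w :: iv) m =
  let crude := (Z.of_nat g * scale ^ Z.of_nat n.+1)%Z in
  if Nat.leb g (coarse n.+1) then crude else
  Z.min crude (w * match n with
    | O => Z.of_nat (sweep_last g P m (head [::] Ls))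
    | _ => sweep (fun c a iv0 m0 =>
             evaluate n (next_tables c Ls) (Nat.min g a) iv0 m0)
           P 0 m (head [::] Ls) iv
    end).
Proof. by case: n. Qed.

Lemma evaluate_ge (n : nat) (cs : seq nat) (Ls : seq (seq nat)) :
  tabulates n cs Ls ->
  gap_bound n cs * IZR scale ^ n <=
    IZR (evaluate n Ls (gap P cs) (inverses (room cs)) (N - sumn cs)).
Proof.
have hscale : 0 < IZR scale by apply: IZR_lt.
elim: n cs Ls => [|n IH] cs Ls htab.
  by rewrite /= Rmult_1_r INR_IZR_INZ; lra.
have crude : gap_bound n.+1 cs * IZR scale ^ n.+1 <=
    IZR (Z.of_nat (gap P cs) * scale ^ Z.of_nat n.+1).
  rewrite mult_IZR -pow_IZR -INR_IZR_INZ; apply: Rmult_le_compat_r.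
    by apply: pow_le; lra.
  exact: gap_bound_le.
case hr: (room cs) => [|r] //.
rewrite -[inverses r.+1]/((scale / Z.of_nat r.+1 + 1)%Z :: inverses r) evaluateS.
case: Nat.leb => //; cbv zeta.
have hr0 : 0 < INR (room cs) by rewrite hr; apply: INR_gt0.
have [hsize htab'] := htab; have [hP htab0] := htab' 0%N isT.
rewrite nth0 in hP htab0.
have hPsize : (P <= size (head [::] Ls))%N by move: hP; rewrite mulSn; lia.
set w := (scale / _ + 1)%Z; set s := (match n with O => _ | _ => _ end).
have hs : (\rsum_(0 <= c < P)
    (if (N <= c + sumn cs)%N then 0 else gap_bound n (c :: cs)))
    * IZR scale ^ n <= IZR s.
  rewrite big_distrl /=.
  rewrite (eq_big_nat _ _ (F2 := fun c => if ((N - sumn cs) + 0 <= c)%N then 0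
      else gap_bound n (c :: cs) * IZR scale ^ n)); last first.
    move=> c _; rewrite addn0 leq_subLR addnC.
    by case: ifP => // _; rewrite Rmult_0_l.
  rewrite /s; case: n IH htab crude {htab' s} hP hsize => [|n] IH htab crude hP hsize.
    rewrite -INR_IZR_INZ.
    apply: Rle_trans (sweep_last_ge (gap P cs) P 0 (N - sumn cs) _ hPsize).
    rewrite add0n; apply: rsum_nat_le => c hc _; case: ifP => _; first lra.
    rewrite subn0 htab0 /=; last lia.
    by rewrite Rmult_1_r; lra.
  have h := sweep_ge (fun c a iv0 m0 =>
      evaluate n.+1 (next_tables c Ls) (Nat.min (gap P cs) a) iv0 m0)
    (fun c => gap_bound n.+1 (c :: cs) * IZR scale ^ n.+1) P 0 (N - sumn cs) r
    (head [::] Ls) hPsize.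
  rewrite add0n in h; apply: h => c hc hm; rewrite add0n.
  rewrite htab0 ?minn_min; last lia.
  have := IH (c :: cs) (next_tables c Ls) (tabulates_next _ _ _ _ hc htab).
  rewrite (_ : room (c :: cs) = r - c)%N; last by move: hr; rewrite /room /=; lia.
  by rewrite (_ : N - sumn (c :: cs) = N - sumn cs - c)%N //= subnDA subnAC.
case: (Z.min_spec (Z.of_nat (gap P cs) * scale ^ Z.of_nat n.+1) (w * s)) => [[_ ->]|[_ ->]] //.
rewrite mult_IZR [gap_bound _ _]/=.
set S := bigop _ _ _ in hs *.
have S_ge0 : 0 <= S.
  apply: rsum_nat_ge0 => c _ _; case: ifP => _; first lra.
  have : forall k cs0, 0 <= gap_bound k cs0.
    elim=> [|k IHk] cs0 /=; first exact: pos_INR.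
    case: eqP => [_|/eqP/room_gt0 h0]; first exact: pos_INR.
    apply: Rmin_glb; first exact: pos_INR.
    apply: Rdiv_le_0_compat => //; apply: rsum_nat_ge0 => c0 _ _.
    by case: ifP => _ //; lra.
  exact.
apply: (Rle_trans _ (S / INR (room cs) * (IZR scale * IZR scale ^ n))).
  apply: Rmult_le_compat_r; last by rewrite {1}hr; apply: Rmin_r.
  by apply: Rmult_le_pos; [lra | apply: pow_le; lra].
have -> : S / INR (room cs) * (IZR scale * IZR scale ^ n)
  = IZR scale / INR (room cs) * (S * IZR scale ^ n) by field; lra.
apply: Rmult_le_compat => //.
- by apply: Rdiv_le_0_compat; lra.
- by apply: Rmult_le_pos => //; apply: pow_le; lra.
by rewrite hr; apply: inverse_ge.
Qed.

Definition root_tables (n : nat) : seq (seq nat) :=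
  mkseq (fun e => mkseq (fun s => gap_shift P [::] e.+1 s) (n * P)) n.

Lemma tabulates_root (n : nat) : tabulates n [::] (root_tables n).
Proof.
split; first by rewrite size_mkseq.
move=> e he; rewrite nth_mkseq // size_mkseq; split=> // s hs.
by rewrite nth_mkseq.
Qed.

End Evaluation.
End Tree.

(** ** The bound for the grid of 96 cells and four picks *)

Definition grid_scale : Z := (2 ^ 20)%Z.

(** The fourth pick is skipped when the gap is at most 4, the third one when it is
    at most 3. *)
Definition coarseness (n : nat) : nat :=
  match n with 2 => 3%N | 1 => 4%N | _ => 0%N end.

Definition grid_value : Z :=
  evaluate 48 grid_scale coarseness 4 (root_tables 48 4) (gap 48 [::])
    (inverses grid_scale (room 48 [::])) (2 * 48 - sumn [::])%N.

Lemma grid_value_le :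
  Z.leb (grid_value * 10000) (grid_scale ^ Z.of_nat 4 * 11904) = true.
Proof. vm_cast_no_check (erefl true). Qed.

Lemma unscale_le (x : R) (G s : Z) : (0 < s)%Z ->
  Z.leb (G * 10000) (s ^ Z.of_nat 4 * 11904) = true ->
  x * IZR s ^ 4 <= IZR G -> x <= 96 * 0.0124.
Proof.
move=> hs /Z.leb_le/IZR_le; rewrite (mult_IZR G) (mult_IZR (s ^ _)) -pow_IZR => h1 h2.
have hp : 0 < IZR s ^ 4 by apply: pow_lt; apply: IZR_lt.
by apply: (Rmult_le_reg_r (IZR s ^ 4)) => //; lra.
Qed.

Lemma gap_bound_grid : gap_bound 48 4 [::] <= 96 * 0.0124.
Proof.
have hscale : (0 < grid_scale)%Z by [].
exact (unscale_le _ grid_value grid_scale hscale grid_value_le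
  (evaluate_ge 48 isT grid_scale coarseness hscale 4 [::] _
    (tabulates_root 48 4))).
Qed.

(** * Pointwise bounds on [h] *)

Lemma rsum_le1 (n : nat) (Q : pred nat) :
  (forall p p', Q p -> Q p' -> p = p') -> \rsum_(1 <= p < n | Q p) 1 <= 1.
Proof.
move=> hQ; elim: n => [|n IH]; first by rewrite big_geq //; lra.
have [->|n_gt0] := posnP n; first by rewrite big_geq //; lra.
rewrite big_mkcond big_nat_recr //= -big_mkcond /=.
case hn: (Q n); last lra.
rewrite big_nat_cond big1; first lra.
by move=> p /andP[hp /hQ /(_ hn)]; lia.
Qed.

Definition no_divisor (X : nat) (alpha : R) (n : nat) : bool :=
  ~~ holds (has_divisor_between (Rpower (INR X) alpha) (Rpower (INR X) (1 / 2)) n).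

Lemma length_filter_seq (f : nat -> bool) (m k : nat) :
  INR (length (List.filter f (List.seq m k))) =
  \big[Rplus/0]_(i <- seq.iota m k | f i) 1.
Proof.
elim: k m => [|k IH] m /=; first by rewrite big_nil.
rewrite big_cons -IH; case: (f m) => //=.
by rewrite -/(INR _.+1) S_INR Rplus_comm.
Qed.

Lemma card_divisor_betweenE (X : nat) (alpha : R) :
  INR (card_divisor_between alpha (1 / 2) (INR X)) =
  INR X - \rsum_(1 <= n < X.+1 | no_divisor X alpha n) 1.
Proof.
have hX : INR X = \rsum_(1 <= n < X.+1) 1 by rewrite rsum_nat_const; ring.
rewrite [X in X - _]hX.
rewrite [X in X - _](bigID (fun n => no_divisor X alpha n)) /=.
rewrite [in RHS]Rplus_comm /Rminus Rplus_assoc Rplus_opp_r Rplus_0_r.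
rewrite /card_divisor_between Int_part_INR Znat.Nat2Z.id /index_iota subn1 /=.
rewrite length_filter_seq; apply: eq_bigl => n.
by rewrite /no_divisor negbK /holds; case: excluded_middle_informative.
Qed.

(** One of [d] and [n / d] is at most [X^(1/2)], and both are at least [X^alpha]
    when [n] is larger than [X^(1 - eps)]. *)
Lemma cofactor_in_window (X n d : nat) (alpha eps : R) :
  1 < INR X -> (0 < n <= X)%N -> Rpower (INR X) (1 - eps) < INR n -> d %| n ->
  Rpower (INR X) alpha <= INR d <= Rpower (INR X) (1 - alpha - eps) ->
  has_divisor_between (Rpower (INR X) alpha) (Rpower (INR X) (1 / 2)) n.
Proof.
move=> hX hn hlow hd [h1 h2].
have [k hk] := dvdnP hd.
have hd0 : 0 < INR d by apply: Rlt_le_trans h1; apply: exp_pos.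
case: (Rle_or_lt (INR d) (Rpower (INR X) (1 / 2))) => h3.
  by exists d; split; [exists k | lra].
exists k; split; first by exists d; rewrite hk mulnC.
have hkd : INR k * INR d = INR n by rewrite hk INR_muln.
have hnX : INR n <= INR X by apply: INR_leq; lia.
split.
  apply: (Rmult_le_reg_r (INR d)) => //; rewrite hkd.
  apply: (Rle_trans _ (Rpower (INR X) alpha * Rpower (INR X) (1 - alpha - eps))).
    by apply: Rmult_le_compat_l => //; apply: Rlt_le; apply: exp_pos.
  rewrite -Rpower_plus (_ : alpha + (1 - alpha - eps) = 1 - eps); last ring.
  lra.
apply: (Rmult_le_reg_r (INR d)) => //; rewrite hkd.
apply: (Rle_trans _ (Rpower (INR X) (1 / 2) * Rpower (INR X) (1 / 2))).
  rewrite -Rpower_plus (_ : 1 / 2 + 1 / 2 = 1); last field.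
  by rewrite Rpower_1; lra.
by apply: Rmult_le_compat_l; [apply: Rlt_le; apply: exp_pos | lra].
Qed.

Lemma count_multiples (X p : nat) : (0 < p)%N ->
  \rsum_(1 <= n < X.+1 | p %| n) 1 = INR (X %/ p).
Proof. by move=> hp; rewrite rsum_multiples // rsum_nat_const; ring. Qed.

Lemma Rpower_small (eps eta : R) : 0 < eps -> 0 < eta ->
  eventually (fun X => Rpower (INR X) (1 - eps) <= eta * INR X).
Proof.
move=> heps heta.
apply: filter_imp (filter_and _ _ eventually_gt1
  (eventually_ln_ge (1 / (eps * eta)))) => X [hX hL].
rewrite /Rminus Rpower_plus Rpower_1; last lra.
rewrite Rmult_comm; apply: Rmult_le_compat_r; first lra.
have hL0 : 0 < ln (INR X) by rewrite -ln_1; apply: ln_increasing; lra.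
rewrite Rpower_Ropp /Rpower -[X in _ <= X]Rinv_inv.
apply: Rinv_le_contravar; first exact: Rinv_0_lt_compat.
have h := exp_ineq1_le (eps * ln (INR X)).
have : eps * (1 / (eps * eta)) <= eps * ln (INR X).
  by apply: Rmult_le_compat_l; lra.
have -> : eps * (1 / (eps * eta)) = / eta by field; lra.
lra.
Qed.

Lemma ln_sub_ge (x eps : R) : 1 / 2 <= x - eps -> 0 <= eps ->
  ln x - 2 * eps <= ln (x - eps).
Proof.
move=> hx heps; have := ln_ge_1_inv ((x - eps) / x).
rewrite ln_div; [|lra|lra] => h.
have h1 : 0 < (x - eps) / x by apply: Rdiv_lt_0_compat; lra.
have := h h1; have -> : 1 - 1 / ((x - eps) / x) = - (eps / (x - eps)).
  by field; lra.
have : eps / (x - eps) <= 2 * eps.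
  apply: (Rmult_le_reg_r (x - eps)); first lra.
  by have -> : eps / (x - eps) * (x - eps) = eps; [field; lra | nra].
lra.
Qed.

(** An integer [n <= X] without divisor in the window is at most [X^(1 - eps)],
    or divisible by a prime beyond [X^(1 - alpha - eps)], or bad.  Taking
    [alpha] strictly below [j / N] leaves room for [eps]. *)
Lemma no_divisor_le (P j : nat) (alpha beta eta : R) :
  (0 < P)%N -> (0 < j <= P)%N ->
  0 <= alpha < INR j / INR (2 * P) -> 0 < eta -> bad_density_le P j [::] beta ->
  eventually (fun X => \rsum_(1 <= n < X.+1 | no_divisor X alpha n) 1
    <= (- ln (1 - alpha) + beta + eta) * INR X).
Proof.
move=> P_gt0 hj halpha heta hbad.
have hN : 0 < INR (2 * P) by apply: INR_gt0; lia.
have hjN : INR j / INR (2 * P) <= 1 / 2.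
  apply: (Rmult_le_reg_r (INR (2 * P))) => //.
  have -> : INR j / INR (2 * P) * INR (2 * P) = INR j by field; lra.
  by have := INR_leq j P ltac:(lia); rewrite INR_muln /=; lra.
set a := INR j / INR (2 * P) in halpha hjN.
(* [ln] has slope at most 2 on [[1/2, 1]], so [eps] costs [2 * eps <= eta / 4]. *)
set eps := Rmin (a - alpha) (eta / 8).
have heps : 0 < eps by apply: Rmin_glb_lt; lra.
have heps1 : eps <= a - alpha by apply: Rmin_l.
have heps2 : eps <= eta / 8 by apply: Rmin_r.
have hrec := recip_cvg (1 - alpha - eps) 1 (eta / 4) ltac:(lra) ltac:(lra) ltac:(lra).
have hsmall := Rpower_small eps (eta / 4) heps ltac:(lra).
apply: filter_imp (filter_and _ _ (filter_and _ _ hrec hsmall)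
  (filter_and _ _ eventually_gt1 hbad)) => X [[hr hs] [hX hb]].
have {}hb := hb [::] isT.
rewrite /bad_count /= divn1 /Rdiv Rinv_1 Rmult_1_r in hb.
pose big p := prime_in (Rpower (INR X) (1 - alpha - eps)) (Rpower (INR X) 1) p.
apply: (Rle_trans _ (\rsum_(1 <= n < X.+1 | holds (INR n <= Rpower (INR X) (1 - eps))) 1
  + \rsum_(1 <= n < X.+1) (\rsum_(1 <= p < X.+1 | big p && (p %| n)) 1)
  + \rsum_(1 <= m < X.+1 | holds (bad P X j (1 * m)%N)) 1)).
  rewrite big_mkcond /= [X in _ <= X + _ + _]big_mkcond /=.
  rewrite [X in _ <= _ + _ + X]big_mkcond -!big_split /=.
  apply: rsum_nat_le => n hn _; rewrite mul1n.
  have hge0 : 0 <= \rsum_(1 <= p < X.+1 | big p && (p %| n)) 1.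
    by apply: rsum_nat_ge0 => *; lra.
  set S := bigop _ _ _ in hge0 *.
  case: holdsP => hsm; first by case: ifP; case: ifP; lra.
  case: holdsP => hbd; first by case: ifP; lra.
  case hno: no_divisor; last lra.
  suff : 1 <= S by lra.
  have hlow : Rpower (INR X) (1 - eps) < INR n by lra.
  have hwin d : d %| n -> ~ (Rpower (INR X) alpha <= INR d
      <= Rpower (INR X) (1 - alpha - eps)).
    move=> hd hw; move/negP: hno; apply; apply/holdsP.
    by apply: cofactor_in_window hw.
  have hpow x y : x <= y -> Rpower (INR X) x <= Rpower (INR X) y.
    by move=> hxy; apply: Rle_Rpower; lra.
  have [p [p_prime hpn hpX]] : exists p, [/\ prime p, p %| n &
      Rpower (INR X) (1 - alpha - eps) < INR p].
    case: (classic (exists p, [/\ prime p, p %| n &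
      Rpower (INR X) (1 - alpha - eps) < INR p])) => // hnone; exfalso.
    apply: hbd; split=> [p p_prime hpn|[d [hd hw]]].
      apply: Rnot_le_lt => hpl; apply: (hwin p hpn); split.
        apply: Rle_trans hpl; apply: hpow; rewrite -/a; lra.
      apply: Rnot_lt_le => hlt; apply: hnone; by exists p.
    apply: (hwin d hd); case: hw => hw1 hw2; split.
      apply: Rle_trans hw1; apply: hpow; rewrite -/a; lra.
    apply: (Rle_trans _ _ _ hw2); apply: hpow.
    rewrite minus_INR; last lia.
    have -> : (INR (2 * P)%N - INR j) / INR (2 * P) = 1 - a.
      by rewrite /a; field; lra.
    lra.
  have hpX' : (p <= X)%N by have := dvdn_leq _ hpn; lia.
  apply: (Rle_trans _ (\rsum_(1 <= q < X.+1 | q == p) 1)).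
    have hpr : (1 <= p < X.+1)%N by rewrite prime_gt0.
    by rewrite big_nat1_eq hpr; apply: Rle_refl.
  apply: rsum_nat_sub => [q _ /eqP ->|*]; last lra.
  rewrite hpn andbT /big /prime_in p_prime; apply/holdsP; split=> //.
  by rewrite Rpower_1; [apply: INR_leq | lra].
apply: (Rle_trans _ (eta / 4 * INR X + INR X * recip X (1 - alpha - eps) 1
   + (beta + 0) * INR X)); last first.
  have := (Rabs_le_between _ _).1 hr; rewrite /Rdiv Rmult_1_l ln_Rinv; last lra.
  have := ln_sub_ge (1 - alpha) eps ltac:(lra) ltac:(lra) => h1 h2.
  nra.
apply: Rplus_le_compat; last by rewrite Rplus_0_r.
apply: Rplus_le_compat.
  apply: Rle_trans hs; apply: count_le_real; first exact: Rlt_le (exp_pos _).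
  by move=> n _ /holdsP.
under eq_bigr => n _ do rewrite big_mkcondr.
rewrite exchange_big /= /recip big_distrr /=; apply: rsum_nat_le => p hp /andP[p_prime _].
rewrite -big_mkcond /= count_multiples ?prime_gt0 //.
exact: INR_divn_le (prime_gt0 p_prime).
Qed.

(** A divisor of [n] is either a multiple of [p], hence larger than [X^(1/2)],
    or has a cofactor divisible by [p], hence is smaller than [X^alpha]. *)
Lemma prime_blocks_window (X n p : nat) (alpha : R) :
  1 < INR X -> alpha <= 1 / 2 -> (0 < n <= X)%N -> prime p -> p %| n ->
  Rpower (INR X) (1 - alpha) < INR p -> no_divisor X alpha n.
Proof.
move=> hX halpha hn p_prime hpn hp; apply/negP => /holdsP[d [[k hk] [h1 h2]]].
have hhalf : Rpower (INR X) (1 / 2) <= Rpower (INR X) (1 - alpha).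
  by apply: Rle_Rpower; lra.
have hpowX x : Rpower (INR X) (1 - x) * Rpower (INR X) x = INR X.
  by rewrite -Rpower_plus (_ : 1 - x + x = 1) ?Rpower_1; [| lra | ring].
have hn0 : 0 < INR n by apply: INR_gt0; lia.
have hnX : INR n <= INR X by apply: INR_leq; lia.
have hd0 : 0 < INR d by apply: Rlt_le_trans h1; apply: exp_pos.
have hnkd : INR n = INR k * INR d by rewrite hk mult_INR.
have : p %| k * d by rewrite (_ : k * d = n)%N.
rewrite Euclid_dvdM // => /orP[hpk|hpd].
  have hk0 : (0 < k)%N by case: (k) hnkd => [|k'] //=; lra.
  have hpk' := INR_leq _ _ (dvdn_leq hk0 hpk).
  have : INR X < INR n.
    rewrite -(hpowX alpha) hnkd; have := exp_pos (alpha * ln (INR X)).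
    rewrite -/(Rpower _ _) => h3.
    apply: (Rlt_le_trans _ (INR p * Rpower (INR X) alpha)).
      exact: Rmult_lt_compat_r.
    by apply: Rmult_le_compat; lra.
  lra.
have hdpos : (0 < d)%N by case: (d) hd0 => [|d'] //=; lra.
by have := INR_leq _ _ (dvdn_leq hdpos hpd); lra.
Qed.

(** Two primes beyond [X^(1/2)] cannot both divide [n <= X], so that the
    multiples of the primes in [(X^(1 - alpha), X^(1 - eps)]] are counted only
    once.  Stopping at [X^(1 - eps)] makes the number of these primes, and so the
    effect of the integer parts [X / p], negligible. *)
Lemma no_divisor_ge (alpha eta : R) : 0 < alpha < 1 / 2 -> 0 < eta ->
  eventually (fun X =>
    (- ln (1 - alpha) - eta) * INR X <=
    \rsum_(1 <= n < X.+1 | no_divisor X alpha n) 1).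
Proof.
move=> halpha heta; set eps := Rmin alpha (eta / 8).
have heps : 0 < eps by apply: Rmin_glb_lt; lra.
have heps1 : eps <= alpha by apply: Rmin_l.
have heps2 : eps <= eta / 8 by apply: Rmin_r.
have hrec := recip_cvg (1 - alpha) (1 - eps) (eta / 4) ltac:(lra) ltac:(lra) ltac:(lra).
have hsmall := Rpower_small eps (eta / 4) heps ltac:(lra).
apply: filter_imp (filter_and _ _ (filter_and _ _ hrec hsmall) eventually_gt1)
  => X [[hr hs] hX].
pose big p := prime_in (Rpower (INR X) (1 - alpha)) (Rpower (INR X) (1 - eps)) p.
apply: (Rle_trans _ (\rsum_(1 <= n < X.+1) (\rsum_(1 <= p < X.+1 | big p && (p %| n)) 1))); last first.
  rewrite [X in _ <= X]big_mkcond /=; apply: rsum_nat_le => n hn _.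
  have hblock p : big p && (p %| n) -> no_divisor X alpha n.
    case/andP=> /andP[p_prime /holdsP[hp _]] hpn.
    by apply: prime_blocks_window hp => //; lra.
  case hno: no_divisor; last first.
    rewrite big1 => [|p /hblock]; first lra.
    by rewrite hno.
  apply: rsum_le1 => p p' /andP[/andP[p_prime /holdsP[hp _]] hpn].
  move=> /andP[/andP[p'_prime /holdsP[hp' _]] hpn'].
  apply/eqP; case: (boolP (p == p')) => // hne; exfalso.
  have hcop : coprime p p' by rewrite prime_coprime // dvdn_prime2.
  have : (p * p' %| n)%N by rewrite Gauss_dvd // hpn hpn'.
  move=> /(dvdn_leq _) hle; have /INR_leq := hle ltac:(lia).
  have := INR_leq n X ltac:(lia).
  rewrite INR_muln => h1 h2.
  have : INR X < INR p * INR p'.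
    have hXX : INR X = Rpower (INR X) (1 / 2) * Rpower (INR X) (1 / 2).
      rewrite -Rpower_plus (_ : 1 / 2 + 1 / 2 = 1); last field.
      by rewrite Rpower_1; lra.
    have hhalf : Rpower (INR X) (1 / 2) <= Rpower (INR X) (1 - alpha).
      by apply: Rle_Rpower; lra.
    have h0 := exp_pos (1 / 2 * ln (INR X)); rewrite -/(Rpower _ _) in h0.
    rewrite [X in X < _]hXX; apply: Rmult_gt_0_lt_compat; lra.
  lra.
under eq_bigr => n _ do rewrite big_mkcondr.
rewrite exchange_big /=.
apply: (Rle_trans _ (\rsum_(1 <= p < X.+1 | big p) (INR X * / INR p - 1))); last first.
  apply: rsum_nat_le => p hp /andP[p_prime _].
  rewrite -big_mkcond /= count_multiples ?prime_gt0 //.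
  exact: Rlt_le (INR_divn_gt _ _ (prime_gt0 p_prime)).
rewrite rsumB -big_distrr /= -/(recip X (1 - alpha) (1 - eps)).
have hcount : \rsum_(1 <= p < X.+1 | big p) 1 <= Rpower (INR X) (1 - eps).
  apply: count_le_real; first exact: Rlt_le (exp_pos _).
  by move=> p _ /andP[_ /holdsP[]].
have := (Rabs_le_between _ _).1 hr; rewrite ln_div; [|lra|lra].
have := ln_sub_ge 1 eps ltac:(lra) ltac:(lra); rewrite ln_1 => h1 h2.
set S := bigop _ _ _ in hcount *; nra.
Qed.

Definition density (alpha : R) (X : nat) : R :=
  INR (card_divisor_between alpha (1 / 2) (INR X)) / INR X.

Lemma h_Lim_density (alpha : R) : h alpha (1 / 2) = real (Lim_seq (density alpha)).
Proof. by []. Qed.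

Lemma density_bounds (alpha : R) (X : nat) : 0 <= density alpha X <= 1.
Proof.
rewrite /density; have [->|X_gt0] := posnP X.
  by rewrite /Rdiv Rinv_0 Rmult_0_r; lra.
have hX := INR_gt0 _ X_gt0; split.
  by apply: Rdiv_le_0_compat => //; apply: pos_INR.
apply: (Rmult_le_reg_r (INR X)) => //.
rewrite card_divisor_betweenE /Rdiv Rmult_assoc Rinv_l; last lra.
have : 0 <= \rsum_(1 <= n < X.+1 | no_divisor X alpha n) 1.
  by apply: rsum_nat_ge0 => *; lra.
by set S := bigop _ _ _; lra.
Qed.

(** [Lim_seq] is the mean of the upper and lower limits; both lie in [[0, 1]], and
    all comparisons below hold for each of them. *)
Lemma Lim_density_finite (alpha : R) :
  Lim_seq (density alpha) = Finite (h alpha (1 / 2)).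
Proof.
have h0 : Rbar_le (Finite 0) (Lim_seq (density alpha)).
  rewrite -(Lim_seq_const 0); apply: Lim_seq_le_loc; exists 0%N => X _.
  exact: (density_bounds alpha X).1.
have h1 : Rbar_le (Lim_seq (density alpha)) (Finite 1).
  rewrite -(Lim_seq_const 1); apply: Lim_seq_le_loc; exists 0%N => X _.
  exact: (density_bounds alpha X).2.
by rewrite h_Lim_density; move: h0 h1; case: (Lim_seq _).
Qed.

Lemma h_le (alpha b : R) : eventually (fun X => density alpha X <= b) ->
  h alpha (1 / 2) <= b.
Proof.
move=> hev; have : Rbar_le (Lim_seq (density alpha)) (Lim_seq (fun _ => b)).
  exact: Lim_seq_le_loc.
by rewrite Lim_seq_const Lim_density_finite.
Qed.

Lemma h_ge (alpha b : R) : eventually (fun X => b <= density alpha X) ->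
  b <= h alpha (1 / 2).
Proof.
move=> hev; have : Rbar_le (Lim_seq (fun _ => b)) (Lim_seq (density alpha)).
  exact: Lim_seq_le_loc.
by rewrite Lim_seq_const Lim_density_finite.
Qed.

Lemma h_antitone (alpha alpha' : R) : alpha <= alpha' ->
  h alpha' (1 / 2) <= h alpha (1 / 2).
Proof.
move=> ha.
have : Rbar_le (Lim_seq (density alpha')) (Lim_seq (density alpha)).
  apply: Lim_seq_le_loc; apply: filter_imp eventually_gt1 => X hX.
  apply: Rmult_le_compat_r; first by apply: Rlt_le; apply: Rinv_0_lt_compat; lra.
  rewrite !card_divisor_betweenE.
  apply: Rplus_le_compat_l; apply: Ropp_le_contravar.
  apply: rsum_nat_sub => [n _ hno|*]; last lra.
  apply: contraNN hno => /holdsP[d [hd [h1 h2]]]; apply/holdsP.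
  exists d; split=> //; split=> //; apply: Rle_trans h1.
  by apply: Rle_Rpower; lra.
by rewrite !Lim_density_finite.
Qed.

Lemma h_bounds (alpha : R) : 0 <= h alpha (1 / 2) <= 1.
Proof.
split; [apply: h_ge | apply: h_le]; exists 0%N => X _.
  exact: (density_bounds alpha X).1.
exact: (density_bounds alpha X).2.
Qed.

Lemma h_upper (alpha : R) : 0 < alpha < 1 / 2 ->
  h alpha (1 / 2) <= 1 + ln (1 - alpha).
Proof.
move=> halpha; apply: le_epsilon => eta heta; apply: h_le.
apply: filter_imp (filter_and _ _ eventually_gt1 (no_divisor_ge _ _ halpha heta))
  => X [hX hno].
apply: (Rmult_le_reg_r (INR X)); first lra.
rewrite /density card_divisor_betweenE /Rdiv Rmult_assoc Rinv_l; lra.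
Qed.

Lemma h_lower (P j : nat) (alpha beta : R) : (0 < P)%N -> (0 < j <= P)%N ->
  0 <= alpha < INR j / INR (2 * P) ->
  (forall eta, 0 < eta -> bad_density_le P j [::] (beta + eta)) ->
  1 + ln (1 - alpha) - beta <= h alpha (1 / 2).
Proof.
move=> hP hj halpha hbeta; apply: le_epsilon => eta heta.
suff : 1 + ln (1 - alpha) - beta - eta <= h alpha (1 / 2) by lra.
apply: h_ge.
have hno := no_divisor_le P j alpha (beta + eta / 2) (eta / 2) hP hj halpha
  ltac:(lra) (hbeta (eta / 2) ltac:(lra)).
apply: filter_imp (filter_and _ _ eventually_gt1 hno) => X [hX {}hno].
apply: (Rmult_le_reg_r (INR X)); first lra.
rewrite /density card_divisor_betweenE /Rdiv Rmult_assoc Rinv_l; last lra.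
move: hno; set S := bigop _ _ _; lra.
Qed.

(** * Integration *)

(** The set where [f >= c] is an initial segment, ending at its least upper
    bound. *)
Lemma ex_RInt_level_set (f : R -> R) (a b c : R) : a <= b ->
  (forall x y, x <= y -> f y <= f x) ->
  ex_RInt (fun x => if holds (c <= f x) then 1 else 0) a b.
Proof.
move=> hab hf.
pose E x := a <= x <= b /\ c <= f x.
case: (classic (exists x, E x)) => [hE|hE]; last first.
  apply: (ex_RInt_ext (fun=> 0)); last exact: ex_RInt_const.
  move=> x; rewrite Rmin_left // Rmax_right // => hx.
  case: holdsP => // hc; exfalso; apply: hE; exists x; split=> //; lra.
have hbound : bound E by exists b => x [[]].
have [t [ht1 ht2]] := completeness E hbound hE.
have hat : a <= t.
  by case: hE => x hx; have := ht1 x hx; case: hx => [[hx _] _]; lra.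
have htb : t <= b by apply: ht2 => x [[]].
apply: (ex_RInt_Chasles _ a t b).
  apply: (ex_RInt_ext (fun=> 1)); last exact: ex_RInt_const.
  move=> x; rewrite Rmin_left // Rmax_right // => hx.
  case: holdsP => // hc; exfalso.
  have : t <= x; last lra.
  apply: ht2 => y [_ hy]; apply: Rnot_lt_le => hxy; apply: hc.
  by have := hf x y (Rlt_le _ _ hxy); lra.
apply: (ex_RInt_ext (fun=> 0)); last exact: ex_RInt_const.
move=> x; rewrite Rmin_left // Rmax_right // => hx.
case: holdsP => // hc; exfalso.
by have := ht1 x (conj (conj (Rle_trans _ _ _ hat (Rlt_le _ _ hx.1))
  (Rlt_le _ _ hx.2)) hc); lra.
Qed.

(** [f] is the uniform limit of its roundings down to multiples of [1 / n], which
    are averages of indicators of level sets. *)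
Lemma ex_RInt_antitone (f : R -> R) (a b : R) : a <= b ->
  (forall x y, x <= y -> f y <= f x) -> (forall x, 0 <= f x <= 1) ->
  ex_RInt f a b.
Proof.
move=> hab hf hf01.
pose g (n : nat) (x : R) : R := / INR n.+1 *
  \rsum_(1 <= k < n.+2) (if holds (INR k / INR n.+1 <= f x) then 1 else 0).
have hg n : ex_RInt (g n) a b.
  apply: (ex_RInt_scal (V := R_NormedModule)).
  elim: (n.+2) => [|m IH].
    apply: (ex_RInt_ext (fun=> 0)); last exact: ex_RInt_const.
    by move=> x _; rewrite big_geq.
  have [->|m_gt0] := posnP m.
    apply: (ex_RInt_ext (fun=> 0)); last exact: ex_RInt_const.
    by move=> x _; rewrite big_geq.
  apply: (ex_RInt_ext (fun x =>
    plus (\rsum_(1 <= k < m) (if holds (INR k / INR n.+1 <= f x) then 1 else 0))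
         (if holds (INR m / INR n.+1 <= f x) then 1 else 0))).
    by move=> x _; rewrite [in RHS]big_nat_recr.
  by apply: ex_RInt_plus => //; apply: ex_RInt_level_set.
have hclose n x : Rabs (g n x - f x) <= / INR n.+1.
  have hn : 0 < INR n.+1 by apply: INR_gt0.
  have [h0 h1] := hf01 x.
  have hfn : 0 <= f x * INR n.+1 <= INR n.+1.
    by split; [apply: Rmult_le_pos | rewrite -[X in _ <= X]Rmult_1_l;
      apply: Rmult_le_compat_r]; lra.
  have [M [hM1 hM2]] := nfloor_ex (f x * INR n.+1) hfn.1.
  have hMn : (M <= n.+1)%N.
    rewrite leqNgt; apply/negP => /INR_leq; rewrite (S_INR n.+1); lra.
  have -> : g n x = / INR n.+1 * INR M.
    rewrite /g; congr (_ * _).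
    rewrite -[RHS]Rmult_1_r -rsum_nat_const.
    have hM' : (M.+1 <= n.+2)%N by [].
    rewrite (big_nat_widen _ _ _ _ _ hM') [in RHS]big_mkcond.
    apply: eq_bigr => k _; congr (if _ then _ else _).
    apply/holdsP/idP => [hk|].
      rewrite ltnS leqNgt; apply/negP => /INR_leq; rewrite S_INR => h2.
      have : INR k / INR n.+1 * INR n.+1 <= f x * INR n.+1.
        by apply: Rmult_le_compat_r => //; apply: Rlt_le.
      have -> : INR k / INR n.+1 * INR n.+1 = INR k by field; lra.
      lra.
    rewrite ltnS => /INR_leq hk; apply: (Rmult_le_reg_r (INR n.+1)) => //.
    have -> : INR k / INR n.+1 * INR n.+1 = INR k by field; lra.
    lra.
  have hi : 0 < / INR n.+1 by apply: Rinv_0_lt_compat.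
  have e1 : f x = / INR n.+1 * (f x * INR n.+1) by field; lra.
  by apply: Rabs_le; rewrite e1; nra.
have hlim : filterlim g eventually
    (locally (f : fct_UniformSpace R R_UniformSpace)).
  apply/filterlim_locally => e.
  have [n [_ hn]] := nfloor_ex (/ e) (Rlt_le _ _ (Rinv_0_lt_compat _ (cond_pos e))).
  exists n => m hm x; apply: Rle_lt_trans (hclose m x) _.
  have hm' : INR n.+1 <= INR m.+1 by apply: le_INR; lia.
  rewrite S_INR in hm'; rewrite -[pos e]Rinv_inv; apply: Rinv_lt_contravar; last lra.
  by have := Rinv_0_lt_compat _ (cond_pos e); nra.
have [I [_ hI]] := filterlim_RInt (V := R_CompleteNormedModule) g a b eventually _ f
  (fun n => RInt (g n) a b) (fun n => RInt_correct _ _ _ (hg n)) hlim.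
by exists I.
Qed.

Lemma nonneg_of_derive (f f' : R -> R) (t : R) : 0 <= t -> f 0 = 0 ->
  (forall x, 0 <= x <= t -> is_derive f x (f' x) /\ 0 <= f' x) -> 0 <= f t.
Proof.
move=> ht f0 hf'.
have [x [hx hfx]] : exists x, 0 <= x <= t /\ f t - f 0 = f' x * (t - 0).
  have [|x hx|x [hx hfx]] := MVT_gen f 0 t f'.
  - move=> x; rewrite Rmin_left // Rmax_right // => hx; apply: (hf' x _).1; lra.
  - rewrite Rmin_left // Rmax_right // in hx.
    by apply/continuity_pt_filterlim; apply: ex_derive_continuous; exists (f' x);
       apply: (hf' x hx).1.
  by rewrite Rmin_left // Rmax_right // in hx; exists x.
have := (hf' x hx).2; nra.
Qed.

(** These are the first terms of the series of [ln ((1 + t) / (1 - t))], the last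
    one being replaced in the upper bound by a geometric majorant of the rest. *)
Lemma ln_ratio_ge (t : R) : 0 <= t < 1 ->
  2 * t + 2 * t ^ 3 / 3 <= ln ((1 + t) / (1 - t)).
Proof.
move=> ht; rewrite ln_div; [|lra|lra].
suff : 0 <= ln (1 + t) - ln (1 - t) - (2 * t + 2 * t ^ 3 / 3) by lra.
apply: (nonneg_of_derive
  (fun x => ln (1 + x) - ln (1 - x) - (2 * x + 2 * x ^ 3 / 3))
  (fun x => 2 * x ^ 4 / (1 - x ^ 2))); first lra.
  by rewrite Rplus_0_r Rminus_0_r ln_1; field.
move=> x hx; split; last by apply: Rdiv_le_0_compat; nra.
auto_derive; first lra.
by field; split; nra.
Qed.

Lemma ln_ratio_le (t : R) : 0 <= t < 1 ->
  ln ((1 + t) / (1 - t)) <= 2 * t + 2 * t ^ 3 / (3 * (1 - t ^ 2)).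
Proof.
move=> ht; rewrite ln_div; [|lra|lra].
suff : 0 <= 2 * t + 2 * t ^ 3 / (3 * (1 - t ^ 2)) - (ln (1 + t) - ln (1 - t)) by lra.
apply: (nonneg_of_derive
  (fun x => 2 * x + 2 * x ^ 3 / (3 * (1 - x ^ 2)) - (ln (1 + x) - ln (1 - x)))
  (fun x => 4 * x ^ 4 / (3 * (1 - x ^ 2) ^ 2))); first lra.
  by rewrite Rplus_0_r Rminus_0_r ln_1; field.
move=> x hx; have hx2 : 0 < 1 - x ^ 2 by nra.
split; last first.
  have h1 := pow_le x 4 hx.1; have h2 := pow_lt _ 2 hx2.
  by apply: Rdiv_le_0_compat; lra.
auto_derive; first by repeat split; nra.
by field; repeat split; nra.
Qed.

Lemma ln2_bounds : 0.6928 <= ln 2 <= 0.698.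
Proof.
split.
  (* [2 = 4/3 * 3/2]; with [t = 1/3] alone, two terms would not suffice. *)
  have -> : 2 = (1 + / 7) / (1 - / 7) * ((1 + / 5) / (1 - / 5)) by field.
  rewrite ln_mult; [|lra|lra].
  have := ln_ratio_ge (/ 7) ltac:(lra); have := ln_ratio_ge (/ 5) ltac:(lra).
  lra.
have -> : 2 = (1 + / 3) / (1 - / 3) by field.
have := ln_ratio_le (/ 3) ltac:(lra); lra.
Qed.

(** The density of the integers up to [X] with no prime factor beyond
    [X^(1 - x)]. *)
Definition h_cap (x : R) : R := 1 + ln (1 - x).

Lemma is_RInt_h_cap (a b : R) : a <= b < 1 ->
  is_RInt h_cap a b ((1 - a) * ln (1 - a) - (1 - b) * ln (1 - b)).
Proof.
move=> hab.
have -> : (1 - a) * ln (1 - a) - (1 - b) * ln (1 - b) =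
    minus (- ((1 - b) * ln (1 - b))) (- ((1 - a) * ln (1 - a))).
  by rewrite /minus /plus /opp /=; ring.
apply: (is_RInt_derive (fun x => - ((1 - x) * ln (1 - x)))) => x.
  rewrite Rmin_left ?Rmax_right; [|lra|lra] => hx.
  by auto_derive; [lra | rewrite /h_cap /Rminus; field; lra].
rewrite Rmin_left ?Rmax_right; [|lra|lra] => hx.
apply: ex_derive_continuous; rewrite /h_cap; auto_derive; lra.
Qed.

Lemma ex_RInt_h (a b : R) : a <= b -> ex_RInt (fun x => h x (1 / 2)) a b.
Proof.
by move=> hab; apply: ex_RInt_antitone => //; [exact: h_antitone | exact: h_bounds].
Qed.

Lemma RInt_h_le : RInt (fun x => h x (1 / 2)) 0 (1 / 2) <= ln 2 / 2.
Proof.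
have hcap := is_RInt_h_cap 0 (1 / 2) ltac:(lra).
have -> : ln 2 / 2 = RInt h_cap 0 (1 / 2).
  rewrite (is_RInt_unique _ _ _ _ hcap) Rminus_0_r ln_1.
  have -> : 1 - 1 / 2 = / 2 by field.
  by rewrite ln_Rinv; [field | lra].
apply: RInt_le; [lra | apply: ex_RInt_h; lra | by eexists; exact: hcap |].
by move=> x hx; apply: h_upper.
Qed.

(** On the [j]-th cell, [h] is bounded below by [h_cap] minus the constant
    [pick_bound P j n [::]]. *)
Lemma RInt_h_ge (P n j : nat) : (0 < P)%N -> (j <= P)%N ->
  RInt h_cap 0 (INR j / INR (2 * P)) -
    / INR (2 * P) * \rsum_(1 <= i < j.+1) pick_bound P i n [::]
  <= RInt (fun x => h x (1 / 2)) 0 (INR j / INR (2 * P)).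
Proof.
move=> P_gt0; have hN : 0 < INR (2 * P) by apply: INR_gt0; lia.
pose t i := INR i / INR (2 * P).
have t_ge0 i : 0 <= t i by apply: Rdiv_le_0_compat => //; apply: pos_INR.
have tS i : t i.+1 = t i + / INR (2 * P) by rewrite /t S_INR; field; lra.
have hinv : 0 < / INR (2 * P) by apply: Rinv_0_lt_compat.
have t_lt1 i : (i <= P)%N -> t i < 1.
  move=> hi; apply: (Rmult_lt_reg_r (INR (2 * P))) => //.
  have -> : t i * INR (2 * P) = INR i by rewrite /t; field; lra.
  by rewrite Rmult_1_l; apply: INR_ltn; lia.
rewrite -/(t j); elim: j => [_|j IH hj].
  rewrite big_geq // Rmult_0_r Rminus_0_r /t /= /Rdiv Rmult_0_l !RInt_point.
  exact: Rle_refl.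
have {}IH := IH (ltnW hj); have hlt := t_lt1 _ hj.
have ecap a b : 0 <= a <= b -> b < 1 -> ex_RInt h_cap a b.
  by move=> hab hb; eexists; apply: is_RInt_h_cap; lra.
have htj := t_ge0 j; have hS := tS j.
rewrite -(RInt_Chasles h_cap 0 (t j) (t j.+1)); last 2 first.
- by apply: ecap; lra.
- by apply: ecap; lra.
rewrite -(RInt_Chasles (fun x => h x (1 / 2)) 0 (t j) (t j.+1)); last 2 first.
- by apply: ex_RInt_h; lra.
- by apply: ex_RInt_h; lra.
rewrite /plus /= big_nat_recr //=.
set B := pick_bound P j.+1 n [::].
have hstep : RInt h_cap (t j) (t j.+1) - / INR (2 * P) * B <=
    RInt (fun x => h x (1 / 2)) (t j) (t j.+1).
  have -> : RInt h_cap (t j) (t j.+1) - / INR (2 * P) * B =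
      RInt (fun x => minus (h_cap x) B) (t j) (t j.+1).
    rewrite RInt_minus; first by rewrite RInt_const tS /minus /plus /opp /scal /=
      /mult /=; ring.
    - by apply: ecap; lra.
    - exact: ex_RInt_const.
  apply: RInt_le; first lra.
  - apply: ex_RInt_minus; first by apply: ecap; lra.
    exact: ex_RInt_const.
  - by apply: ex_RInt_h; lra.
  move=> x hx; rewrite /h_cap /minus /plus /opp /=.
  apply: (h_lower P j.+1 x B P_gt0); [lia | by rewrite -/(t j.+1); lra |].
  by move=> eta heta; apply: bad_density_pick_bound.
move: IH hstep; set S := bigop _ _ _; lra.
Qed.

Theorem corollary1p3 :
  forall c : R,
    c = 1 - RInt (fun alpha : R => h alpha (1 / 2)) 0 (1 / 2) ->
    0.651 <= c <= 0.666.
Proof.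
move=> c ->; have := ln2_bounds; have := RInt_h_le.
have := RInt_h_ge 48 4 48 isT isT; have := sum_pick_bound 48 isT 4 [::].
have := gap_bound_grid.
have -> : INR 48 / INR (2 * 48) = 1 / 2 by rewrite INR_muln /=; field.
have -> : INR (2 * 48) = 96 by rewrite INR_muln /=; ring.
rewrite (is_RInt_unique _ _ _ _ (is_RInt_h_cap 0 (1 / 2) ltac:(lra))).
rewrite Rminus_0_r ln_1 (_ : 1 - 1 / 2 = / 2); last field.
rewrite ln_Rinv; last lra.
set S := bigop _ _ _; set G := gap_bound _ _ _; lra.
Qed.
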